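(* If $X$ and $Y$ are Banach spaces such that either $X^\ast$ or $Y$ has the approximation property and both $\mathrm{Sz}(X^\ast)$ and $\mathrm{Sz}(Y)$ are at most $\omega$, then $$\mathsf{p}(\mathcal{K}(X,Y))=\max\{\mathsf{p}(X^\ast),\mathsf{p}(Y)\},$$ where $\mathcal{K}(X,Y)$ is the space of compact operators from $X$ to $Y$. In particular, for all $1<p,q<\infty$ we have $$\mathsf{p}(\mathcal{K}(\ell_p,\ell_q))=\max\Bigl\{p,\frac{q}{q-1}\Bigr\}.$$
   Context: The space $\mathcal{K}(X,Y)$ carries the operator norm. For a Banach space $X$, $B_X$ denotes its unit ball. For a weak$^\ast$-compact set $K\subset X^\ast$ and $\varepsilon>0$, the $\varepsilon$-Szlenk derivation is $$\iota_\varepsilon K=\{x^\ast\in K:\ \mathrm{diam}(K\cap U)>\varepsilon\text{ for every }w^\ast\text{-open neighborhood }U\text{ of }x^\ast\},$$ with iterates $\iota^0_\varepsilon K=K$, $\iota_\varepsilon^{\alpha+1}K=\iota_\varepsilon(\iota_\varepsilon^\alpha K)$, and $\iota_\varepsilon^\alpha K=\bigcap_{\beta<\alpha}\iota_\varepsilon^\beta K$ for limit $\alpha$. $\mathrm{Sz}(X,\varepsilon)$ is the least ordinal $\alpha$ (if any) with $\iota_\varepsilon^\alpha B_{X^\ast}=\varnothing$, and $\mathrm{Sz}(X)=\sup_{\varepsilon>0}\mathrm{Sz}(X,\varepsilon)$. The condition $\mathrm{Sz}(X)\leq\omega$ is equivalent to $\mathrm{Sz}(X,\varepsilon)$ being finite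 for every $\varepsilon>0$. For $\mathrm{Sz}(X)\le\omega$ the following finite limit, called the Szlenk power type of $X$, exists: $$\mathsf{p}(X)=\lim_{\varepsilon\to0+}\frac{\log\mathrm{Sz}(X,\varepsilon)}{|\log\varepsilon|}.$$
   Formalization: X and Y are assumed to be nonzero: for X = {0} and Y = ℓ_2 all hypotheses hold, but K(X,Y) = {0} has Szlenk power type 0 while max{p(X* ), p(Y)} = 2. *)

(* Defs.v *)
From HB Require Import structures.
From mathcomp Require Import all_boot all_order all_algebra.
From mathcomp Require Import all_classical all_reals all_analysis.
From mathcomp Require Import complex.

Set Implicit Arguments.
Unset Strict Implicit.
Unset Printing Implicit Defensive.

Import Order.TTheory GRing.Theory Num.Theory.
Import numFieldNormedType.Exports.

Local Open Scope classical_set_scope.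
Local Open Scope ring_scope.

(* Banach spaces are real or complex: everything is parametrized by the choice
   of the scalar field. *)
Variant scalars := RealScalars | ComplexScalars.

Definition scalar_field (R : realType) (s : scalars) : numFieldType :=
  match s with
  | RealScalars => R
  | ComplexScalars => R[i]
  end.

Section scalar_field.
Context (R : realType) (s : scalars).
Local Notation K := (scalar_field R s).

Definition of_real : R -> K :=
  match s with
  | RealScalars => id
  | ComplexScalars => fun x => x%:C%C
  end.

Definition to_real : K -> R :=
  match s with
  | RealScalars => id
  | ComplexScalars => @complex.Re R
  end.

Lemma of_realK : cancel of_real to_real.
Proof. by rewrite /of_real /to_real /scalar_field; case: s. Qed.

Lemma of_realD : {morph of_real : x y / x + y}.
Proof.
rewrite /of_real /scalar_field; case: s => // x y.
exact: (rmorphD (real_complex R)).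
Qed.

Lemma of_realM : {morph of_real : x y / x * y}.
Proof.
rewrite /of_real /scalar_field; case: s => // x y.
exact: (rmorphM (real_complex R)).
Qed.

Lemma of_real0 : of_real 0 = 0.
Proof. by rewrite /of_real /scalar_field; case: s. Qed.

Lemma of_real1 : of_real 1 = 1.
Proof. by rewrite /of_real /scalar_field; case: s. Qed.

Lemma ler_of_real : {mono of_real : x y / x <= y}.
Proof.
rewrite /of_real /scalar_field; case: s => // x y.
exact: lecR.
Qed.

Lemma to_realK (x : K) : 0 <= x -> of_real (to_real x) = x.
Proof.
rewrite /of_real /to_real; move: x; rewrite /scalar_field; case: s => // x.
rewrite lecE => /andP[/eqP/= Ix _].
by case: x Ix => a b /= ->.
Qed.

End scalar_field.

Section real_norm.
Context (R : realType) (s : scalars).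
Local Notation K := (scalar_field R s).
Context (V : normedModType K).
Implicit Types x y : V.

(* `|x| lives in the scalar field; rnorm x is the same number, in R. *)
Definition rnorm x : R := to_real `|x|.

Lemma rnormE x : of_real s (rnorm x) = `|x|.
Proof. exact: to_realK. Qed.

Lemma rnorm_ge0 x : 0 <= rnorm x.
Proof. by rewrite -(ler_of_real s) of_real0 rnormE. Qed.

Lemma ler_rnormD x y : rnorm (x + y) <= rnorm x + rnorm y.
Proof. by rewrite -(ler_of_real s) of_realD !rnormE ler_normD. Qed.

Lemma rnorm0_eq0 x : rnorm x = 0 -> x = 0.
Proof.
by move=> x0; apply/eqP; rewrite -normr_eq0 -rnormE x0 of_real0.
Qed.

Lemma rnorm0 : rnorm 0 = 0.
Proof. by apply: (can_inj (of_realK s)); rewrite rnormE normr0 of_real0. Qed.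

Definition unit_ball : set V := [set x | rnorm x <= 1].

Definition diam (A : set V) : \bar R :=
  ereal_sup [set (rnorm (z.1 - z.2))%:E | z in A `*` A].

End real_norm.

Lemma rnormZ (R : realType) (s : scalars) (V : normedModType (scalar_field R s))
    (a : scalar_field R s) (x : V) :
  rnorm (a *: x) = rnorm (a : (scalar_field R s)^o) * rnorm x.
Proof.
by apply: (can_inj (of_realK s)); rewrite of_realM !rnormE normrZ.
Qed.

Lemma rnorm_of_real (R : realType) (s : scalars) (r : R) : 0 <= r ->
  rnorm (of_real s r : (scalar_field R s)^o) = r.
Proof.
move=> r0; apply: (can_inj (of_realK s)); rewrite rnormE ger0_norm//.
by rewrite -(of_real0 R s) ler_of_real.
Qed.

Section bounded_operators.
Context (R : realType) (s : scalars).
Local Notation K := (scalar_field R s).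
Context (X Y : normedModType K).

Definition bounded_op_pred : {pred X -> Y} :=
  [pred T | `[< linear T /\ continuous T >]].

(* L(X, Y), with the operator norm. *)
Record bounded_op := BoundedOp {
  bounded_op_fun :> X -> Y ;
  _ : bounded_op_fun \in bounded_op_pred }.

HB.instance Definition _ := [isSub for bounded_op_fun].
HB.instance Definition _ := [Choice of bounded_op by <:].

Lemma bounded_op_predP T :
  reflect (linear T /\ continuous T) (T \in bounded_op_pred).
Proof. exact: asboolP. Qed.

Lemma bounded_op_submod_closed : submod_closed bounded_op_pred.
Proof.
split.
  apply/bounded_op_predP; split; last by move=> x; exact: cvg_cst.
  by move=> a x y; rewrite -[LHS]/(0 : Y) -[RHS]/(a *: (0 : Y) + 0) scaler0 addr0.
move=> a f g /bounded_op_predP[lf cf] /bounded_op_predP[lg cg].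
apply/bounded_op_predP; split.
  move=> b x y; rewrite -[LHS]/(a *: f (b *: x + y) + g (b *: x + y)).
  rewrite -[RHS]/(b *: (a *: f x + g x) + (a *: f y + g y)).
  by rewrite lf lg !scalerDr !scalerA (mulrC a b) addrACA.
move=> x; apply: (@cvgD _ _ _ (nbhs x)); last exact: cg.
by apply: cvgZr; exact: cf.
Qed.

HB.instance Definition _ :=
  GRing.isSubmodClosed.Build _ _ bounded_op_pred bounded_op_submod_closed.
HB.instance Definition _ := [SubChoice_isSubLmodule of bounded_op by <:].

Implicit Types (S T : bounded_op) (x y : X).

Lemma bounded_op_linear T : linear T.
Proof. by case: (bounded_op_predP _ (valP T)). Qed.

Lemma bounded_op_continuous T : continuous T.
Proof. by case: (bounded_op_predP _ (valP T)). Qed.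

Lemma bounded_opZ T (a : K) x : T (a *: x) = a *: T x.
Proof.
have T0 : T 0 = 0.
  have := bounded_op_linear T 1 0 0.
  by rewrite !scale1r addr0 => /eqP; rewrite -subr_eq0 opprD addNKr oppr_eq0 => /eqP.
by have := bounded_op_linear T a x 0; rewrite T0 !addr0.
Qed.

Definition opnorm T : R := sup [set rnorm (T x) | x in unit_ball (V := X)].

Lemma opnorm_has_sup T : has_sup [set rnorm (T x) | x in unit_ball (V := X)].
Proof.
split; first by exists (rnorm (T 0)), 0 => //; rewrite /unit_ball/= rnorm0.
have T0 : T 0 = 0 by rewrite -(scale0r 0) bounded_opZ scale0r.
have := @bounded_op_continuous T 0; rewrite /continuous_at T0.
move=> /cvgr0Pnorm_lt /(_ 1 ltr01) /nbhs_norm0P[/= d d0 dT].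
have [e e0 ed] : exists2 e, 0 < e & e < d.
  by exists (d / 2); rewrite ?divr_gt0// ltr_pdivrMr// ltr_pMr// ltr1n.
exists (to_real e^-1) => _ [x x1 <-].
rewrite -(ler_of_real s) to_realK ?invr_ge0 ?(ltW e0)// rnormE.
rewrite -[leRHS]mulr1 ler_pdivlMl//.
have := dT (e *: x); rewrite bounded_opZ normrZ gtr0_norm// => h.
apply/ltW/h => /=; rewrite normrZ gtr0_norm// (le_lt_trans _ ed)//.
rewrite -[leRHS]mulr1 ler_pM2l//.
by rewrite -rnormE -(of_real1 R s) ler_of_real.
Qed.

Lemma rnorm_le_opnorm T x : rnorm x <= 1 -> rnorm (T x) <= opnorm T.
Proof. by move=> x1; apply: sup_upper_bound (opnorm_has_sup T) _ _; exists x. Qed.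

Lemma rnorm_bounded_op T x : rnorm (T x) <= opnorm T * rnorm x.
Proof.
have [->|x0] := eqVneq x 0.
  by rewrite -{1}(scale0r 0) bounded_opZ scale0r !rnorm0 mulr0.
have nx0 : 0 < rnorm x.
  rewrite lt0r rnorm_ge0 andbT; apply: contra_neq x0; exact: rnorm0_eq0.
have nV : 0 <= (rnorm x)^-1 by rewrite invr_ge0 rnorm_ge0.
rewrite -ler_pdivrMr// mulrC -{1}(rnorm_of_real s nV) -rnormZ -bounded_opZ.
by apply: rnorm_le_opnorm; rewrite rnormZ rnorm_of_real// mulVf// gt_eqF.
Qed.

Lemma opnorm_le T M : (forall x, rnorm x <= 1 -> rnorm (T x) <= M) ->
  opnorm T <= M.
Proof.
move=> TM; apply: ge_sup; first by case: (opnorm_has_sup T).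
by move=> _ [x x1 <-]; exact: TM.
Qed.

Lemma opnorm_ge0 T : 0 <= opnorm T.
Proof.
by rewrite (le_trans (rnorm_ge0 _) (rnorm_le_opnorm T (x := 0) _))// rnorm0.
Qed.

Let norm T : K := of_real s (opnorm T).

Let norm_ler_normD S T : norm (S + T) <= norm S + norm T.
Proof.
rewrite /norm -of_realD ler_of_real; apply: opnorm_le => x x1.
by rewrite (le_trans (ler_rnormD _ _))// lerD// rnorm_le_opnorm.
Qed.

Let opnormZ_le (a : K) T : opnorm (a *: T) <= rnorm (a : K^o) * opnorm T.
Proof.
apply: opnorm_le => x x1; rewrite -[X in rnorm X]/(a *: T x) rnormZ.
by rewrite ler_wpM2l// ?rnorm_ge0 ?rnorm_le_opnorm.
Qed.

Let norm_normrZ (a : K) T : norm (a *: T) = `|a| * norm T.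
Proof.
rewrite -[`|a|](@rnormE _ _ K^o) /norm -of_realM; congr of_real.
apply/eqP; rewrite eq_le opnormZ_le/=.
have [->|a0] := eqVneq a 0; first by rewrite rnorm0 mul0r opnorm_ge0.
have na0 : 0 < rnorm (a : K^o).
  rewrite lt0r rnorm_ge0 andbT; apply: contra_neq a0.
  exact: (@rnorm0_eq0 _ _ K^o).
rewrite -ler_pdivlMl// (_ : _^-1 = rnorm (a^-1 : K^o)); last first.
  apply: (can_inj (of_realK s)); rewrite rnormE normfV -(@rnormE _ _ K^o).
  apply: (mulfI (x := of_real s (rnorm (a : K^o)))).
    by rewrite rnormE normr_eq0.
  by rewrite divff ?rnormE ?normr_eq0// -rnormE -of_realM divff ?gt_eqF ?of_real1.
by rewrite -{1}[T](scalerK a0) scalerA mulVf// scale1r -{1}[T]scale1r -(mulVf a0) -scalerA opnormZ_le.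
Qed.

Let norm_eq0 T : norm T = 0 -> T = 0.
Proof.
rewrite /norm -(of_real0 R s) => /(can_inj (of_realK s)) T0.
apply/val_inj/funext => x /=; apply: rnorm0_eq0; apply/eqP.
rewrite eq_le rnorm_ge0 andbT.
by rewrite (le_trans (rnorm_bounded_op T x))// T0 mul0r.
Qed.

HB.instance Definition _ := @Lmodule_isNormed.Build K bounded_op norm
  norm_ler_normD norm_normrZ norm_eq0.

End bounded_operators.

Section compact_operators.
Context (R : realType) (s : scalars).
Local Notation K := (scalar_field R s).
Context (X Y : normedModType K).

Definition compact_op_pred : {pred bounded_op X Y} :=
  [pred T : bounded_op X Y | `[< compact (closure (T @` unit_ball (V := X))) >]].

(* K(X, Y), normed as a subspace of L(X, Y). *)
Record compact_op := CompactOp {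
  compact_op_val :> bounded_op X Y ;
  _ : compact_op_val \in compact_op_pred }.

HB.instance Definition _ := [isSub for compact_op_val].
HB.instance Definition _ := [Choice of compact_op by <:].

Lemma compact_op_submod_closed : submod_closed compact_op_pred.
Proof.
have compact_cl (A B : set Y) : A `<=` B -> compact B -> compact (closure A).
  move=> AB cB; apply: (subclosed_compact _ cB); first exact: closed_closure.
  rewrite [X in _ `<=` X](closure_id B).1; first exact: closureS.
  exact: (compact_closed (@norm_hausdorff _ Y) cB).
split.
  apply/asboolP; apply: (@compact_cl _ [set 0]); last exact: compact_set1.
  by move=> _ [x _ <-].
move=> a S T /asboolP cS /asboolP cT; apply/asboolP.
pose f (z : Y * Y) := a *: z.1 + z.2.
apply: (@compact_cl _ (f @` (closure (S @` unit_ball (V := X)) `*`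
                             closure (T @` unit_ball (V := X))))).
  move=> _ [x x1 <-]; exists (S x, T x) => //.
  by split; apply: subset_closure; exists x.
apply: continuous_compact; last exact: compact_setX.
apply: continuous_subspaceT => z; apply: cvgD; last exact: cvg_snd.
by apply: cvgZr; exact: cvg_fst.
Qed.

HB.instance Definition _ :=
  GRing.isSubmodClosed.Build _ _ compact_op_pred compact_op_submod_closed.
HB.instance Definition _ := [SubChoice_isSubLmodule of compact_op by <:].

Let norm (T : compact_op) : K := `|compact_op_val T|.

Let norm_ler_normD S T : norm (S + T) <= norm S + norm T.
Proof. exact: ler_normD. Qed.

Let norm_normrZ (a : K) T : norm (a *: T) = `|a| * norm T.
Proof. exact: normrZ. Qed.

Let norm_eq0 T : norm T = 0 -> T = 0.
Proof. by move=> /normr0_eq0 T0; exact: val_inj. Qed.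

HB.instance Definition _ := @Lmodule_isNormed.Build K compact_op norm
  norm_ler_normD norm_normrZ norm_eq0.

End compact_operators.

Section ell_norm.
Context (R : realType) (s : scalars) (p : R) (p1 : 1 <= p).
Local Notation K := (scalar_field R s).
Implicit Types x y : nat -> K^o.

Definition ell_norm x : \bar R :=
  ('N[counting]_(p%:E)[EFin \o (fun n => rnorm (x n))])%E.

Let p0 : 0 < p. Proof. exact: lt_le_trans p1. Qed.

Lemma ell_normE x :
  ell_norm x = ((\sum_(n <oo) (rnorm (x n) `^ p)%:E) `^ p^-1)%E.
Proof.
rewrite /ell_norm Lnorm_counting//; congr (_ `^ _)%E; apply: eq_eseriesr => n _.
by rewrite /= ger0_norm ?rnorm_ge0.
Qed.

Let series_ge0 x : (0 <= \sum_(n <oo) (rnorm (x n) `^ p)%:E)%E.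
Proof. by apply: nneseries_ge0 => n _ _; rewrite lee_fin powR_ge0. Qed.

Lemma ell_norm_ge0 x : (0 <= ell_norm x)%E.
Proof. exact: Lnorm_ge0. Qed.

Lemma ell_normD x y : (ell_norm (x \+ y)%R <= ell_norm x + ell_norm y)%E.
Proof.
apply: (@le_trans _ _
    ('N[counting]_(p%:E)[EFin \o (fun n => rnorm (x n) + rnorm (y n))%R])%E).
  rewrite ell_normE Lnorm_counting//; apply: gt0_ler_poweR.
  - by rewrite invr_ge0 ltW.
  - by rewrite in_itv/= leey andbT.
  - by rewrite in_itv/= leey andbT nneseries_ge0// => n _ _; exact: poweR_ge0.
  apply: lee_nneseries => [n _ _|n _]; first by rewrite lee_fin powR_ge0.
  rewrite /= lee_fin ge0_ler_powR ?nnegrE ?rnorm_ge0 ?(ltW p0)//.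
  by rewrite (le_trans (ler_rnormD _ _))// ler_norm.
by apply: minkowski_EFin => //.
Qed.

Lemma ell_normZ (a : K) x :
  (ell_norm (a \*: x)%R = (rnorm (a : K^o))%:E * ell_norm x)%E.
Proof.
rewrite !ell_normE.
under eq_eseriesr do rewrite /= rnormZ powRM ?rnorm_ge0// EFinM.
rewrite nneseriesZl; last by move=> n _; rewrite lee_fin powR_ge0.
rewrite poweRM ?lee_fin ?powR_ge0//; congr (_ * _)%E.
by rewrite poweR_EFin -powRrM mulfV ?gt_eqF// powRr1 ?rnorm_ge0.
Qed.

Lemma ell_norm_eq0 x : ell_norm x = 0%E -> x = 0.
Proof.
rewrite ell_normE => /poweR_eq0_eq0 => /(_ (series_ge0 x)) x0.
apply/funext => n; apply: rnorm0_eq0.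
have : ((rnorm (x n) `^ p)%:E <= 0)%E.
  rewrite -[leRHS]x0 (nneseriesD1 (n := n))//; last first.
    by move=> k _; rewrite lee_fin powR_ge0.
  by rewrite leeDl// nneseries_ge0// => k _ _; rewrite lee_fin powR_ge0.
rewrite lee_fin => xn; have /eqP : rnorm (x n) `^ p = 0.
  by apply/eqP; rewrite eq_le xn powR_ge0.
by rewrite powR_eq0 => /andP[/eqP].
Qed.

Definition ell_pred : {pred nat -> K^o} := [pred x | (ell_norm x < +oo)%E].

End ell_norm.

(* The sequence space l_p; p1 is what makes it a normed space. *)
Record ell (R : realType) (s : scalars) (p : R) (p1 : 1 <= p) := Ell {
  ell_seq :> nat -> (scalar_field R s)^o ;
  _ : ell_seq \in @ell_pred R s p }.

Arguments ell {R} s {p} p1.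

Section ell.
Context (R : realType) (s : scalars) (p : R) (p1 : 1 <= p).
Local Notation K := (scalar_field R s).
Local Notation ell := (ell s p1).

HB.instance Definition _ := [isSub of ell for @ell_seq R s p p1].
HB.instance Definition _ := [Choice of ell by <:].

Lemma ell_submod_closed : submod_closed (@ell_pred R s p).
Proof.
split.
  rewrite inE (ell_normE p1) eseries0 ?poweR0r ?invr_neq0 ?gt_eqF ?ltry ?(lt_le_trans ltr01)//.
  by move=> n _ _; rewrite rnorm0 powR0// gt_eqF// (lt_le_trans ltr01).
move=> a x y; rewrite !inE => xoo yoo.
rewrite (le_lt_trans (ell_normD p1 (a \*: x) y))// lte_add_pinfty//.
by rewrite (ell_normZ p1) lte_mul_pinfty// lee_fin rnorm_ge0.
Qed.

HB.instance Definition _ :=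
  GRing.isSubmodClosed.Build _ _ (@ell_pred R s p) ell_submod_closed.
HB.instance Definition _ := [SubChoice_isSubLmodule of ell by <:].

Let norm (x : ell) : K := of_real s (fine (ell_norm p x)).

Let ell_norm_fin (x : ell) : (fine (ell_norm p x))%:E = ell_norm p x.
Proof. by rewrite fineK// ge0_fin_numE ?ell_norm_ge0//; exact: (valP x). Qed.

Let norm_ler_normD (x y : ell) : norm (x + y) <= norm x + norm y.
Proof.
rewrite /norm -of_realD ler_of_real -lee_fin EFinD !ell_norm_fin.
exact: (ell_normD p1).
Qed.

Let norm_normrZ (a : K) (x : ell) : norm (a *: x) = `|a| * norm x.
Proof.
rewrite -[`|a|](@rnormE _ _ K^o) /norm -of_realM; congr of_real.
by apply: EFin_inj; rewrite EFinM !ell_norm_fin; exact: (ell_normZ p1).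
Qed.

Let norm_eq0 (x : ell) : norm x = 0 -> x = 0.
Proof.
rewrite /norm -(of_real0 R s) => /(can_inj (of_realK s)) x0.
by apply/val_inj/(ell_norm_eq0 p1); rewrite -ell_norm_fin x0.
Qed.

HB.instance Definition _ := @Lmodule_isNormed.Build K ell norm
  norm_ler_normD norm_normrZ norm_eq0.

End ell.

Section dual.
Context (R : realType) (s : scalars).
Local Notation K := (scalar_field R s).
Context (V : normedModType K).

Definition dual := bounded_op V K^o.

Definition dual_eval (f : dual) : {ptws V -> K^o} := f.

(* The carrier of V^* with the topology of pointwise convergence. *)
Definition weak_star := initial_topology dual_eval.

End dual.

Section approximation_property.
Context (R : realType) (s : scalars).
Local Notation K := (scalar_field R s).

Definition finite_rank (V W : normedModType K) (T : bounded_op V W) :=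
  exists n (w : 'I_n -> W), forall x, exists c : 'I_n -> K,
    T x = \sum_(i < n) c i *: w i.

(* The identity is a limit of bounded finite-rank operators, uniformly on
   compact sets. *)
Definition approximation_property (V : normedModType K) :=
  forall (C : set V) (e : R), compact C -> 0 < e ->
    exists2 T : bounded_op V V, finite_rank T &
      forall x, C x -> rnorm (T x - x) <= e.

End approximation_property.

(* Ordinals as well-founded trees; OSup f is the supremum of the family f, with
   0 as the supremum of the empty family. Distinct trees may represent the same
   ordinal: equality of ordinals is ord_le in both directions. *)
Inductive Ord : Type :=
| OZero
| OSucc of Ord
| OSup (I : Type) of (I -> Ord).

Inductive ord_le : Ord -> Ord -> Prop :=
| ord_le_zero b : ord_le OZero b
| ord_le_succ a b : ord_le a b -> ord_le (OSucc a) (OSucc b)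
| ord_le_sup_l I (f : I -> Ord) b : (forall i, ord_le (f i) b) ->
    ord_le (OSup f) b
| ord_le_sup_r I (f : I -> Ord) a i : ord_le a (f i) -> ord_le a (OSup f).

Definition ord_of_nat (n : nat) : Ord := iter n OSucc OZero.

Definition ord_omega : Ord := OSup ord_of_nat.

Section szlenk.
Context (R : realType) (s : scalars).
Local Notation K := (scalar_field R s).
Context (V : normedModType K).
Implicit Types (e : R) (A : set (dual V)) (a b : Ord).

Definition szlenk_derivation e A : set (dual V) :=
  [set f | A f /\ forall U : set (weak_star V), open U -> U f ->
             (e%:E < diam (A `&` (U : set (dual V))))%E].

(* The iterates decrease, so that the last clause agrees with the second one
   when the supremum is attained; the intersection with A is relevant for the
   empty family only. *)
Fixpoint szlenk_iter e A a : set (dual V) :=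
  match a with
  | OZero => A
  | OSucc b => szlenk_derivation e (szlenk_iter e A b)
  | OSup J f => A `&` \bigcap_i szlenk_iter e A (f i)
  end.

(* Sz(V, e) exists and is equal to a. *)
Definition is_szlenk_eps e a :=
  szlenk_iter e (unit_ball (V := dual V)) a = set0 /\
  forall b, szlenk_iter e (unit_ball (V := dual V)) b = set0 -> ord_le a b.

(* Sz(V) exists and is equal to a, the least upper bound of the Sz(V, e). *)
Definition is_szlenk a :=
  (forall e, 0 < e -> exists2 b, is_szlenk_eps e b & ord_le b a) /\
  (forall c, (forall e b, 0 < e -> is_szlenk_eps e b -> ord_le b c) ->
     ord_le a c).

Definition szlenk_le_omega := exists2 a, is_szlenk a & ord_le a ord_omega.

(* Sz(V, e) as a natural number, 0 if it is not one. *)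
Definition szlenk_nat e : nat :=
  xget 0%N [set n | is_szlenk_eps e (ord_of_nat n)].

(* Meaningful when szlenk_le_omega holds: the limit then exists. *)
Definition szlenk_power_type : R :=
  lim ((fun e => ln (szlenk_nat e)%:R / `|ln e|) @ 0^'+).

End szlenk.

(* Main.v *)
Require Import Defs.
From mathcomp Require Import all_boot all_order all_algebra.
From mathcomp Require Import all_classical all_reals all_analysis.
From mathcomp Require Import complex ring lra zify.

Set Implicit Arguments.
Unset Strict Implicit.
Unset Printing Implicit Defensive.

Import Order.TTheory GRing.Theory Num.Theory.
Import numFieldNormedType.Exports.

Local Open Scope classical_set_scope.
Local Open Scope ring_scope.

(** The dual ball of K(X, Y) is the weak*-closed convex hull of the functionals
    T |-> g(h o T), with g in the ball of X** and h in the ball of Y*; for a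
    compact T these depend weak*-continuously on the pair (g, h).

    If the n-th e-derivative of the dual ball of a space Z is nonempty, then the
    ball of Z contains a weakly null tree of height n along each branch of which
    the sum has norm at least n e / 10. For Z = K(X, Y), norm the branch sums by
    pairs (g, h) and pass to the limit from the leaves to the root: this gives a
    pair (g, h) and a_1, ..., a_n <= 1 with sum at least n e / 10, where each
    a_i > t costs one derivation of order t / 2 at g or at h. Hence at most
    Sz(X*, t / 2) + Sz(Y, t / 2) - 2 of the a_i exceed t. When both indices are
    O(t^-r) with r > 1, summation over dyadic t gives n = O(e^-r); taking values
    at all levels t rather than the convex hull at one level is what avoids the
    loss of a power of e. Exponents below 1 do not interfere, as a power type is
    at least 1 unless the first derivatives are all empty.

    Conversely, X* and Y are complemented in K(X, Y), through rank-one operators.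

    For l_p and its dual, the upper bound comes from the same trees, whose branch
    sums have norm at most (2n)^(1/p), resp. (2n)^(1/p'), for a suitable branch; the
    lower bound comes from normalized sums of n distinct unit vectors. *)

(** * Scalars and norms *)

Section scalars.
Context (R : realType) (s : scalars).
Local Notation K := (scalar_field R s).
Local Notation re := (@to_real R s).
Implicit Types (x y : K) (a : R).

Lemma to_realD : {morph re : x y / x + y}.
Proof.
by rewrite /to_real /scalar_field; case: s => // -[a b] [c d].
Qed.

Lemma to_realMl a x : re (of_real s a * x) = a * re x.
Proof.
rewrite /to_real /of_real; move: x; rewrite /scalar_field; case: s => // -[b c].
by rewrite /= mul0r subr0.
Qed.

Lemma to_real0 : re 0 = 0.
Proof. by rewrite -[X in re X](of_real0 R s) of_realK. Qed.

Lemma to_realN : {morph re : x / - x}.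
Proof.
by move=> x; apply/eqP; rewrite -addr_eq0 -to_realD addNr to_real0.
Qed.

Lemma to_realB : {morph re : x y / x - y}.
Proof. by move=> x y; rewrite to_realD to_realN. Qed.

Lemma of_realN : {morph @of_real R s : a / - a}.
Proof.
by move=> a; apply/eqP; rewrite -addr_eq0 -of_realD addNr of_real0.
Qed.

Lemma ltr_of_real : {mono @of_real R s : a b / a < b}.
Proof. by move=> a b; rewrite !lt_neqAle ler_of_real (can_eq (of_realK s)). Qed.

Lemma to_real_gt0 x : 0 < x -> 0 < re x.
Proof.
by move=> x0; rewrite -ltr_of_real of_real0 to_realK// ltW.
Qed.

Lemma ler_to_real x : re x <= rnorm (x : K^o).
Proof.
rewrite /rnorm /to_real; move: x; rewrite /scalar_field; case: s => [x|[a b]].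
  exact: ler_norm.
rewrite normc_def /=; apply: (le_trans (ler_norm _)).
by rewrite -sqrtr_sqr ler_sqrt ?addr_ge0 ?sqr_ge0// lerDl sqr_ge0.
Qed.

Lemma ler_norm_to_real x : `|re x| <= rnorm (x : K^o).
Proof.
rewrite ler_norml ler_to_real andbT lerNl -to_realN.
by rewrite (le_trans (ler_to_real _))// /rnorm normrN.
Qed.

(** Lets real parts stand in for moduli, uniformly over both scalar fields. *)
Lemma phase x : exists2 u : K, rnorm (u : K^o) <= 1 & u * x = of_real s (rnorm (x : K^o)).
Proof.
have [->|x0] := eqVneq x 0.
  by exists 0; rewrite ?mul0r rnorm0 ?ler01 ?of_real0.
exists (`|x| / x); last by rewrite divfK// rnormE.
by rewrite /rnorm normrM normfV normr_id divff ?normr_eq0// -(of_real1 R s) of_realK.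
Qed.

Lemma rnorm_to_real_sup (x : K) M :
  (forall u : K, rnorm (u : K^o) <= 1 -> re (u * x) <= M) -> rnorm (x : K^o) <= M.
Proof.
have [u u1 ux] := phase x.
by move=> /(_ u u1); rewrite ux of_realK.
Qed.

(** Compactness of [[- M, M]] gives a cluster point, and an ultrafilter converges to each of its
    cluster points. Limits along ultrafilters take the place of subsequences throughout. *)
Lemma ultra_bounded_real (I : Type) (F : set_system I) (u : I -> R) (M : R) :
  UltraFilter F -> (forall i, `|u i| <= M) ->
  exists2 l, `|l| <= M & u @ F --> l.
Proof.
move=> UF uM.
have cM : compact `[- M, M]%classic by exact: segment_compact.
move: cM => /(_ (u @ F) _ _)[].
  change (F (u @^-1` `[- M, M]%classic)).
  by apply: filterS filterT => i _; rewrite /= in_itv/= -ler_norml.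
move=> l [lM clu]; exists l; first by move: lM; rewrite /= in_itv/= -ler_norml.
move=> A lA.
have [//|] := in_ultra_setVsetC (u @^-1` A) UF.
move=> FnA; have [y [nAy Ay]] := clu (~` A) A FnA lA.
by [].
Qed.

Lemma cvg_rnormP (V : normedModType K) (I : Type) (F : set_system I) (FF : Filter F) (u : I -> V) l :
  (u @ F --> l) <-> (forall e : R, 0 < e -> \forall i \near F, rnorm (u i - l) < e).
Proof.
split=> [/cvgr_distC_lt ul e e0|ul].
  have e0' : 0 < of_real s e by rewrite -(of_real0 R s) ltr_of_real.
  have := ul _ e0'; apply: filterS => i.
  by rewrite -rnormE ltr_of_real.
apply/cvgrPdistC_lt => e e0.
have := ul _ (to_real_gt0 e0); apply: filterS => i.
by rewrite -rnormE -[X in _ -> _ < X](to_realK (ltW e0)) ltr_of_real.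
Qed.

Lemma ultra_bounded_scalar (I : Type) (F : set_system I) (u : I -> K^o) (M : R) :
  UltraFilter F -> (forall i, rnorm (u i) <= M) ->
  exists l : K^o, u @ F --> l.
Proof.
move=> UF uM.
(* Only this form of convergence survives the case split on the scalar field: it mentions no
   topology on [K]. The complex case treats real and imaginary parts separately. *)
suff [l lP] : exists l : K, forall e, 0 < e ->
    \forall i \near F, rnorm (u i - l : K^o) < e.
  by exists l; apply/cvg_rnormP.
move: u uM; rewrite /rnorm /to_real /scalar_field; case: s => u uM.
  have [l _ /cvgr_distC_lt ul] := ultra_bounded_real UF uM.
  by exists l => e e0; apply: ul.
have bRe i : `|complex.Re (u i)| <= M.
  rewrite (le_trans _ (uM i))// normc_def /= -sqrtr_sqr ler_sqrt ?addr_ge0 ?sqr_ge0//.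
  by rewrite lerDl sqr_ge0.
have bIm i : `|complex.Im (u i)| <= M.
  rewrite (le_trans _ (uM i))// normc_def /= -sqrtr_sqr ler_sqrt ?addr_ge0 ?sqr_ge0//.
  by rewrite lerDr sqr_ge0.
have [a _ /cvgr_distC_lt ua] := ultra_bounded_real UF bRe.
have [b _ /cvgr_distC_lt ub] := ultra_bounded_real UF bIm.
exists (a +i* b)%C => e e0.
have e20 : 0 < e / 2 by rewrite divr_gt0.
near=> i.
have ha : `|complex.Re (u i) - a| < e / 2 by near: i; exact: ua.
have hb : `|complex.Im (u i) - b| < e / 2 by near: i; exact: ub.
rewrite normc_def /=; apply: (@le_lt_trans _ _ (`|complex.Re (u i) - a| + `|complex.Im (u i) - b|)).
  case: (u i) => c d /=.
  rewrite -[leRHS]ger0_norm ?addr_ge0// -[leRHS]sqrtr_sqr ler_sqrt ?sqr_ge0//.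
  have sq (z : R) : z ^+ 2 = `|z| ^+ 2 by rewrite real_normK ?num_real.
  by rewrite (sq (c - a)) (sq (d - b)) sqrrD addrAC lerDl mulrn_wge0// mulr_ge0.
by rewrite [ltRHS]splitr ltrD.
Unshelve. all: by end_near.
Qed.

End scalars.

Section norms.
Context (R : realType) (s : scalars).
Local Notation K := (scalar_field R s).
Context (V : normedModType K).
Implicit Types x y : V.

Lemma rnormN x : rnorm (- x) = rnorm x.
Proof. by rewrite /rnorm normrN. Qed.

Lemma ler_rnormB x y : rnorm (x - y) <= rnorm x + rnorm y.
Proof. by rewrite -(rnormN y) ler_rnormD. Qed.

Lemma rnorm_distC x y : rnorm (x - y) = rnorm (y - x).
Proof. by rewrite -rnormN opprB. Qed.

Lemma ler_rnorm_dist x y z : rnorm (x - z) <= rnorm (x - y) + rnorm (y - z).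
Proof. by rewrite -(subrK y x) -addrA addrK ler_rnormD. Qed.

Lemma rnormZ_real (a : R) x : 0 <= a -> rnorm (of_real s a *: x) = a * rnorm x.
Proof. by move=> a0; rewrite rnormZ rnorm_of_real. Qed.

Lemma ler_rnorm_sum (I : Type) (r : seq I) (f : I -> V) :
  rnorm (\sum_(i <- r) f i) <= \sum_(i <- r) rnorm (f i).
Proof.
elim: r => [|i r IH]; first by rewrite !big_nil rnorm0.
by rewrite !big_cons (le_trans (ler_rnormD _ _))// lerD2l.
Qed.

End norms.

(** * Bounded operators *)

Section operators.
Context (R : realType) (s : scalars).
Local Notation K := (scalar_field R s).
Context (V W : normedModType K).
Implicit Types (T : bounded_op V W) (x y : V).

Lemma bounded_opD T x y : T (x + y) = T x + T y.
Proof. by rewrite -[x in LHS]scale1r bounded_op_linear scale1r. Qed.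

Lemma bounded_op0 T : T 0 = 0.
Proof. by rewrite -(scale0r 0) bounded_opZ scale0r. Qed.

Lemma bounded_opN T x : T (- x) = - T x.
Proof. by rewrite -scaleN1r bounded_opZ scaleN1r. Qed.

Lemma bounded_opB T x y : T (x - y) = T x - T y.
Proof. by rewrite bounded_opD bounded_opN. Qed.

Lemma bounded_op_sum T (I : Type) (r : seq I) (f : I -> V) :
  T (\sum_(i <- r) f i) = \sum_(i <- r) T (f i).
Proof.
by elim/big_ind2 : _ => [|x a y b <- <-|]; rewrite ?bounded_op0 ?bounded_opD.
Qed.

Lemma sum_bounded_opE (I : Type) (r : seq I) (f : I -> bounded_op V W) x :
  (\sum_(i <- r) f i) x = \sum_(i <- r) f i x.
Proof. by elim/big_ind2 : _ => // ? ? ? ? <- <-. Qed.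

Lemma rnorm_opE T : rnorm T = opnorm T.
Proof. exact: of_realK. Qed.

Lemma ler_rnorm_op T x : rnorm (T x) <= rnorm T * rnorm x.
Proof. by rewrite rnorm_opE rnorm_bounded_op. Qed.

Lemma rnorm_op_le T M : (forall x, rnorm x <= 1 -> rnorm (T x) <= M) -> rnorm T <= M.
Proof. by rewrite rnorm_opE; exact: opnorm_le. Qed.

Lemma rnorm_op_gt T c : c < rnorm T -> exists2 x, rnorm x <= 1 & c < rnorm (T x).
Proof.
move=> cT; apply: contrapT => h; move: cT; apply/negP; rewrite -leNgt.
apply: rnorm_op_le => x x1; rewrite leNgt; apply/negP => cx.
by apply: h; exists x.
Qed.

Section bounded_op_of.
Context (f : V -> W) (lf : linear f) (M : R).
Hypothesis fM : forall x, rnorm (f x) <= M * rnorm x.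

Lemma bounded_linear_continuous : continuous f.
Proof.
move=> x; apply/cvg_rnormP => e e0; apply/nbhs_normP.
(* No sign is known for [M], whence the absolute value; the [+ 1] keeps the divisor positive. *)
have M1 : 0 < `|M| + 1 by rewrite ltr_wpDl.
have d0 : 0 < e / (`|M| + 1) by rewrite divr_gt0.
exists (of_real s (e / (`|M| + 1))).
  by rewrite /= -(of_real0 R s) ltr_of_real.
move=> y; rewrite /ball_/= -rnormE ltr_of_real rnorm_distC => yx.
have -> : f y - f x = f (y - x).
  by rewrite addrC -[x]scale1r -scaleN1r scale1r -lf addrC scaleN1r.
apply: (le_lt_trans (fM _)); apply: (@le_lt_trans _ _ ((`|M| + 1) * rnorm (y - x))).
  rewrite ler_wpM2r ?rnorm_ge0// (le_trans (ler_norm M))// lerDl ler01//.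
by rewrite mulrC -ltr_pdivlMr.
Qed.

Lemma bounded_op_of_subproof : f \in @bounded_op_pred R s V W.
Proof. apply/bounded_op_predP; split => //; exact: bounded_linear_continuous. Qed.

Definition bounded_op_of : bounded_op V W := BoundedOp bounded_op_of_subproof.

Lemma rnorm_bounded_op_of : 0 <= M -> rnorm bounded_op_of <= M.
Proof.
move=> M0; apply: rnorm_op_le => x x1; apply: (le_trans (fM x)).
by rewrite ler_piMr.
Qed.

End bounded_op_of.

End operators.

(** * The weak* topology and the Banach-Alaoglu theorem *)

Section weak_star.
Context (R : realType) (s : scalars).
Local Notation K := (scalar_field R s).
Context (V : normedModType K).
Implicit Types (f g : dual V) (v : V).

Lemma weak_star_eval_continuous v : continuous (fun f : weak_star V => (f : dual V) v : K^o).
Proof.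
move=> f; apply: (@cvg_comp _ _ _ (dual_eval (V := V) : weak_star V -> {ptws V -> K^o})
  (fun g : {ptws V -> K^o} => g v) (nbhs f) (nbhs (dual_eval f)) (nbhs (f v : K^o))).
  exact: initial_continuous.
exact: (@proj_continuous V (fun _ => K^o) v).
Qed.

Lemma cvg_weak_star (I : Type) (F : set_system I) (FF : Filter F) (u : I -> dual V) f :
  (forall v, (u i v : K^o) @[i --> F] --> (f v : K^o)) ->
  (u i : weak_star V) @[i --> F] --> (f : weak_star V).
Proof.
move=> uf.
have h : (dual_eval (u i)) @[i --> F] --> (dual_eval f).
  by apply/pointwise_cvgP.
move=> A /= [_ [[B oB <-] /= fB BA]].
have /h : nbhs (dual_eval f) B by apply: open_nbhs_nbhs.
change (F (fun i => B (dual_eval (u i))) -> F (fun i => A (u i))); apply: filterS => i; exact: BA.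
Qed.

Lemma weak_star_nbhs (I : Type) (F : set_system I) (FF : Filter F) (u : I -> dual V) f
   (U : set (weak_star V)) :
  (forall v, (u i v : K^o) @[i --> F] --> (f v : K^o)) ->
  open U -> U f -> \forall i \near F, U (u i).
Proof.
move=> uf oU Uf; have := cvg_weak_star FF uf.
by apply; apply: open_nbhs_nbhs.
Qed.

(** Banach-Alaoglu along an ultrafilter: the values at each vector are bounded, hence converge, and
    linearity and the norm bound pass to the pointwise limit. *)
Lemma alaoglu_ultra (I : Type) (F : set_system I) (UF : UltraFilter F) (u : I -> dual V) :
  (forall i, rnorm (u i) <= 1) ->
  exists2 f : dual V, rnorm f <= 1 & forall v, (u i v : K^o) @[i --> F] --> (f v : K^o).
Proof.
move=> u1.
have uv v i : rnorm (u i v) <= rnorm v.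
  by rewrite (le_trans (ler_rnorm_op _ _))// ler_piMl ?rnorm_ge0.
have /choice[l ul] : forall v, exists l : K^o, (u i v : K^o) @[i --> F] --> l.
  by move=> v; apply: ultra_bounded_scalar; exact: uv.
have ll : linear (l : V -> K^o).
  move=> a x y; apply: (cvg_unique (@norm_hausdorff _ K^o) (ul _)).
  have -> : (fun i => u i (a *: x + y) : K^o) = (fun i => a *: (u i x : K^o) + (u i y : K^o)).
    by apply/funext => i; rewrite bounded_op_linear.
  by apply: cvgD; [apply: cvgZl_tmp; exact: ul|exact: ul].
have l1 x : rnorm (l x) <= 1 * rnorm x.
  rewrite mul1r; apply/ler_addgt0Pr => e e0.
  have /cvg_rnormP/(_ e e0)/filter_ex[i hi] := ul x.
  rewrite -[l x](subrK (u i x)) addrC (le_trans (ler_rnormD _ _))// lerD//.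
  by rewrite rnorm_distC ltW.
exists (bounded_op_of ll l1); first exact: rnorm_bounded_op_of.
exact: ul.
Qed.

End weak_star.

(** * The Szlenk derivation *)

Section diam.
Context (R : realType) (s : scalars) (V : normedModType (scalar_field R s)).
Implicit Types (A : set V) (e : R).

Lemma diam_gtP A e :
  (e%:E < diam A)%E <-> exists x y, [/\ A x, A y & e < rnorm (x - y)].
Proof.
split=> [/ereal_sup_gt[_ [[x y] [/= Ax Ay] <-]]|[x [y [Ax Ay exy]]]].
  by rewrite lte_fin => exy; exists x, y.
apply: (@lt_le_trans _ _ (rnorm (x - y))%:E); first by rewrite lte_fin.
by apply: ereal_sup_ubound; exists (x, y).
Qed.

End diam.

Section derivation.
Context (R : realType) (s : scalars).
Local Notation K := (scalar_field R s).
Context (V : normedModType K).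
Implicit Types (e : R) (A : set (dual V)) (f g : dual V).

Definition szlenk_n e A (n : nat) := szlenk_iter e A (ord_of_nat n).

Lemma szlenk_nS e A n : szlenk_n e A n.+1 = szlenk_derivation e (szlenk_n e A n).
Proof. by []. Qed.

Lemma szlenk_derivationP e A f : szlenk_derivation e A f <->
  A f /\ forall U : set (weak_star V), open U -> U f ->
    exists g h : dual V, [/\ A g, A h, U g, U h & e < rnorm (g - h)].
Proof.
split=> -[Af h]; split => // U oU Uf.
  have /diam_gtP[x [y [[Ax Ux] [Ay Uy] exy]]] := h _ oU Uf.
  by exists x, y.
have [x [y [Ax Ay Ux Uy exy]]] := h _ oU Uf.
by apply/diam_gtP; exists x, y.
Qed.

Lemma not_szlenk_derivation e A f : A f -> ~ szlenk_derivation e A f ->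
  exists U : set (weak_star V), [/\ open U, U f &
    forall g h, A g -> U g -> A h -> U h -> rnorm (g - h) <= e].
Proof.
move=> Af /szlenk_derivationP nf; apply: contrapT => nU; apply: nf; split => // U oU Uf.
apply: contrapT => ngh; apply: nU; exists U; split => // g h Ag Ug Ah Uh.
by rewrite leNgt; apply/negP => egh; apply: ngh; exists g, h.
Qed.

Lemma szlenk_derivation_sub e A : szlenk_derivation e A `<=` A.
Proof. by move=> f []. Qed.

Lemma szlenk_derivation_subset e e' A A' : e' <= e -> A `<=` A' ->
  szlenk_derivation e A `<=` szlenk_derivation e' A'.
Proof.
move=> ee AA f /szlenk_derivationP[Af h]; apply/szlenk_derivationP.
split=> [|U oU Uf]; first exact: AA.
have [x [y [Ax Ay Ux Uy exy]]] := h _ oU Uf; exists x, y; split => //.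
- exact: AA.
- exact: AA.
- exact: le_lt_trans exy.
Qed.

Lemma szlenk_n_subset e e' A A' n : e' <= e -> A `<=` A' ->
  szlenk_n e A n `<=` szlenk_n e' A' n.
Proof.
by move=> ee AA; elim: n => // n IH; exact: szlenk_derivation_subset.
Qed.

Lemma szlenk_n_decr e A m n : (m <= n)%N -> szlenk_n e A n `<=` szlenk_n e A m.
Proof.
move=> /subnK <-; elim: (n - m)%N => // k IH.
by apply: subset_trans IH; exact: szlenk_derivation_sub.
Qed.

Lemma szlenk_nD e A m n : szlenk_n e A (m + n) = szlenk_n e (szlenk_n e A n) m.
Proof. by elim: m => // m IH; rewrite addSn !szlenk_nS IH. Qed.

(** The derivation is local: neighborhoods of a point of the open set [U] may be shrunk into [U]. *)
Lemma szlenk_derivation_setI e A (U : set (weak_star V)) : open U ->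
  szlenk_derivation e A `&` (U : set (dual V)) `<=`
  szlenk_derivation e (A `&` (U : set (dual V))).
Proof.
move=> oU f [/szlenk_derivationP[Af h] Uf]; apply/szlenk_derivationP; split => // U' oU' U'f.
have [x [y [Ax Ay [Ux U'x] [Uy U'y] exy]]] :=
  h (U `&` U') (openI oU oU') (conj Uf U'f).
by exists x, y.
Qed.

Lemma szlenk_n_setI e A (U : set (weak_star V)) n : open U ->
  szlenk_n e A n `&` (U : set (dual V)) `<=`
  szlenk_n e (A `&` (U : set (dual V))) n.
Proof.
move=> oU; elim: n => // n IH f hf.
by apply: (szlenk_derivation_subset (lexx e) IH); exact: szlenk_derivation_setI.
Qed.

(** The derived sets are weak*-closed in [A]: at the stage where [f] is removed, the neighborhood of
    small diameter that removes it removes all its points. *)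
Lemma not_szlenk_n_open e A n f : A f -> ~ szlenk_n e A n f ->
  exists U : set (weak_star V), [/\ open U, U f & forall g, U g -> ~ szlenk_n e A n g].
Proof.
move=> Af; elim: n => // n IH nf.
have [Anf|nAnf] := pselect (szlenk_n e A n f); last first.
  have [U [oU Uf UA]] := IH nAnf; exists U; split => // g Ug Ang.
  by apply: (UA _ Ug); exact: szlenk_derivation_sub Ang.
have [U [oU Uf UA]] := not_szlenk_derivation Anf nf.
exists U; split => // g Ug /szlenk_derivationP[Ag /(_ _ oU Ug)[x [y [Ax Ay Ux Uy]]]].
by apply/negP; rewrite -leNgt; exact: UA.
Qed.

End derivation.

Section transfer.
Context (R : realType) (s : scalars).
Local Notation K := (scalar_field R s).
Context (V W : normedModType K) (t : dual V -> dual W) (c : R).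
Hypothesis c0 : 0 < c.
Hypothesis t_cont : forall w, continuous (fun f : weak_star V => (t f w : K^o)).
Hypothesis t_norm : forall f g, c * rnorm (f - g) <= rnorm (t f - t g).

(** Neighborhoods of [t f] pull back to neighborhoods of [f], and points more than [e] apart are
    sent more than [c * e] apart. Applied to affine maps and to adjoints of projections. *)
Lemma szlenk_derivation_transfer e (A : set (dual V)) (A' : set (dual W)) f :
  (forall g, A g -> A' (t g)) -> szlenk_derivation e A f ->
  szlenk_derivation (c * e) A' (t f).
Proof.
move=> AA' /szlenk_derivationP[Af h]; apply/szlenk_derivationP.
split=> [|U oU Utf]; first exact: AA'.
have oU' : @open (weak_star V) (t @^-1` U).
  rewrite openE => g Ug.
  apply: (@weak_star_nbhs _ _ W (weak_star V) (nbhs (g : weak_star V)) _ t (t g) U _ oU Ug) => w.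
  exact: t_cont.
have [x [y [Ax Ay Ux Uy exy]]] := h _ oU' Utf.
exists (t x), (t y); split => //; [exact: AA'|exact: AA'|].
by rewrite (lt_le_trans _ (t_norm _ _))// ltr_pM2l.
Qed.

Lemma szlenk_n_transfer e (A : set (dual V)) (A' : set (dual W)) n f :
  (forall g, A g -> A' (t g)) -> szlenk_n e A n f ->
  szlenk_n (c * e) A' n (t f).
Proof.
move=> AA'; elim: n f => [|n IH] f; first exact: AA'.
by apply: szlenk_derivation_transfer => g; exact: IH.
Qed.

End transfer.

Section affine.
Context (R : realType) (s : scalars).
Local Notation K := (scalar_field R s).
Context (V : normedModType K).

Lemma affine_weak_star_continuous (a : R) (f0 : dual V) v :
  continuous (fun f : weak_star V => ((of_real s a *: (f : dual V) + f0 : dual V) v : K^o)).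
Proof.
move=> f; have h := @weak_star_eval_continuous R s V v f.
exact: (cvgD (cvgZl_tmp (k := of_real s a) h) (cvg_cst (f0 v))).
Qed.

Lemma szlenk_n_affine (a : R) (f0 : dual V) e (A A' : set (dual V)) n f : 0 < a ->
  (forall g, A g -> A' (of_real s a *: g + f0)) -> szlenk_n e A n f ->
  szlenk_n (a * e) A' n (of_real s a *: f + f0).
Proof.
move=> a0; apply: (@szlenk_n_transfer _ _ _ _ (fun g => of_real s a *: g + f0)) => //.
  exact: affine_weak_star_continuous.
by move=> g h; rewrite opprD addrACA subrr addr0 -scalerBr rnormZ_real// ltW.
Qed.

End affine.

(** * Finite ordinals, and the index as a natural number *)

Lemma ord_le_nat_inv m n : ord_le (ord_of_nat m) (ord_of_nat n) -> (m <= n)%N.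
Proof.
elim: m n => // m IH [|n] h; inversion h; subst.
by rewrite ltnS IH.
Qed.

(** Needed to make the least natural index least among all ordinals. At a supremum, either some
    member of the family reaches [n], or all of them stay below it. *)
Lemma ord_le_nat_total n b :
  ord_le (ord_of_nat n) b \/ (0 < n)%N /\ ord_le b (ord_of_nat n.-1).
Proof.
elim: b n => [|b IH|I f IH] [|n]; try by left; exact: ord_le_zero.
- by right; split => //; exact: ord_le_zero.
- have [nb|[n0 bn]] := IH n; first by left; exact: ord_le_succ.
  by right; split => //=; rewrite -(prednK n0); exact: ord_le_succ.
- have [[i ni]|h] := pselect (exists i, ord_le (ord_of_nat n.+1) (f i)).
    by left; exact: ord_le_sup_r ni.
  right; split => //; apply: ord_le_sup_l => i.
  by have [ni|[]//] := IH i n.+1; case: h; exists i.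
Qed.

Section nat_index.
Context (R : realType) (s : scalars).
Local Notation K := (scalar_field R s).
Context (V : normedModType K).
Implicit Types (e : R) (n : nat).
Local Notation B := (unit_ball (V := dual V)).

Lemma szlenk_iter_sub e (A : set (dual V)) b : szlenk_iter e A b `<=` A.
Proof.
by elim: b => [//|b IH|I f _ g []//]; apply: subset_trans IH; exact: szlenk_derivation_sub.
Qed.

Lemma szlenk_iter_ord_le e (A : set (dual V)) a b : ord_le a b ->
  szlenk_iter e A b `<=` szlenk_iter e A a.
Proof.
elim => {a b} [b|a b _ IH|I f b _ IH|I f a i _ IH].
- exact: szlenk_iter_sub.
- exact: szlenk_derivation_subset.
- move=> g bg; split; last by move=> i _; exact: (IH i).
  exact: szlenk_iter_sub bg.
- by move=> g [_ /(_ i Logic.I)]; exact: IH.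
Qed.

(** The working form of [szlenk_le_omega], free of ordinals; [szlenk_le_omegaP] relates the two. *)
Definition finite_szlenk := forall e, 0 < e -> exists n, szlenk_n e B n = set0.

Lemma szlenk_nat_is_szlenk_eps e : (exists n, szlenk_n e B n = set0) ->
  is_szlenk_eps V e (ord_of_nat (szlenk_nat V e)).
Proof.
move=> h; apply: (@xgetPex _ 0%N [set n | is_szlenk_eps V e (ord_of_nat n)]).
have h' : exists n, `[< szlenk_n e B n = set0 >].
  by have [n nB] := h; exists n; apply/asboolP.
case: (ex_minnP h') => n /asboolP n0 nmin; exists n; split => // b b0.
have [//|[npos bn]] := ord_le_nat_total n b.
have : szlenk_n e B n.-1 = set0.
  by rewrite -subset0 -b0; exact: szlenk_iter_ord_le.
by move=> /asboolP /nmin; rewrite leqNgt prednK// leqnn.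
Qed.

Lemma szlenk_nat_eq0 e : (exists n, szlenk_n e B n = set0) ->
  szlenk_n e B (szlenk_nat V e) = set0.
Proof. by move=> /szlenk_nat_is_szlenk_eps[]. Qed.

Lemma szlenk_nat_le e n : szlenk_n e B n = set0 -> (szlenk_nat V e <= n)%N.
Proof.
move=> n0; have [_] := szlenk_nat_is_szlenk_eps (ex_intro _ n n0).
by move=> /(_ _ n0) /ord_le_nat_inv.
Qed.

Lemma unit_ball0 : B 0.
Proof. by rewrite /unit_ball/= rnorm0 ler01. Qed.

Lemma szlenk_nat_gt0 e : (exists n, szlenk_n e B n = set0) -> (0 < szlenk_nat V e)%N.
Proof.
move=> h; rewrite lt0n; apply/eqP => n0; have := szlenk_nat_eq0 h.
by rewrite n0 => /seteqP[/(_ _ unit_ball0)].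
Qed.

(** Weak* compactness: points of the successive derivatives have a limit along a free ultrafilter,
    and it lies in every derivative because these decrease and are closed. *)
Lemma szlenk_iter_omega_neq0 e : (forall n, szlenk_n e B n !=set0) ->
  szlenk_iter e B ord_omega !=set0.
Proof.
move=> /choice[u un].
have [F [UF ooF]] := ultraFilterLemma eventually_filter.
have u1 n : rnorm (u n) <= 1 by have /(szlenk_n_decr (leq0n n)) := un n.
have [f f1 uf] := alaoglu_ultra UF u1.
exists f; split => // n _ /=; apply: contrapT => nf.
have [U [oU Uf UA]] := not_szlenk_n_open (f1 : B f) nf.
have FU : \forall i \near F, U (u i) by exact: (weak_star_nbhs _ uf).
have Fn : F [set i | (n <= i)%N] by apply: ooF; exact: nbhs_infty_ge.
have [i [Ui ni]] := filter_ex (filterI FU Fn).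
apply: (UA _ Ui); exact: szlenk_n_decr ni _ (un i).
Qed.

Lemma szlenk_le_omegaP : szlenk_le_omega V <-> finite_szlenk.
Proof.
split=> [[a [ha _] aoo] e e0|fin].
  have [b [b0 _] ba] := ha e e0.
  apply: contrapT => nn; have [f fo] : szlenk_iter e B ord_omega !=set0.
    apply: szlenk_iter_omega_neq0 => n; apply/set0P/eqP => n0.
    by apply: nn; exists n.
  by have /(szlenk_iter_ord_le ba) := szlenk_iter_ord_le aoo fo; rewrite b0.
exists (OSup (fun e : {e : R | 0 < e} => ord_of_nat (szlenk_nat V (sval e)))).
  split=> [e e0|c hc].
    exists (ord_of_nat (szlenk_nat V e)); first exact: szlenk_nat_is_szlenk_eps (fin e e0).
    apply: (@ord_le_sup_r _ _ _ (exist _ e e0)) => /=.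
    by elim: (szlenk_nat V e) => [|n IH]; [exact: ord_le_zero|exact: ord_le_succ].
  apply: ord_le_sup_l => -[e e0] /=; apply: (hc e _ e0).
  exact: szlenk_nat_is_szlenk_eps (fin e e0).
apply: ord_le_sup_l => e; apply: (@ord_le_sup_r _ _ _ (szlenk_nat V (sval e))).
by elim: (szlenk_nat V _) => [|n IH]; [exact: ord_le_zero|exact: ord_le_succ].
Qed.

End nat_index.

(** * The power type *)

Section power_type.
Context (R : realType) (s : scalars).
Local Notation K := (scalar_field R s).
Context (V : normedModType K).
Implicit Types (e a b r : R) (n : nat).
Local Notation B := (unit_ball (V := dual V)).
Local Notation N := (szlenk_nat V).
Hypothesis fin : finite_szlenk V.

Lemma szlenk_nat_anti e e' : 0 < e -> e <= e' -> (N e' <= N e)%N.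
Proof.
move=> e0 ee; apply: szlenk_nat_le; rewrite -subset0 -(szlenk_nat_eq0 (fin e0)).
exact: szlenk_n_subset.
Qed.

(** A point removed by a derivation of order [a] has a neighborhood of diameter at most [a];
    translated and divided by [a], this piece fits into the ball, so [N b] derivations of order
    [a * b] exhaust it. *)
Lemma szlenk_nat_submul a b : 0 < a -> 0 < b -> (N (a * b) <= N a * N b)%N.
Proof.
move=> a0 b0; apply: szlenk_nat_le; rewrite -subset0 -(szlenk_nat_eq0 (fin a0)).
(* The induction shows that [n * N b] derivations of order [a * b] remove at least as much as [n]
   derivations of order [a]. *)
elim: (N a) => // n IH; rewrite mulSn szlenk_nD.
set A := szlenk_n (a * b) B (n * N b) in IH *.
move=> f fA; have Af : A f by exact: szlenk_n_decr (leq0n _) _ fA.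
apply: contrapT => /(not_szlenk_derivation (IH _ Af))[U [oU Uf Ua]].
have aV0 : 0 < a^-1 by rewrite invr_gt0.
have := szlenk_n_setI oU (conj fA Uf).
move=> /(@szlenk_n_affine _ _ _ a^-1 (- (of_real s a^-1 *: f)) _ _ B _ _ aV0).
rewrite mulrA mulVf ?gt_eqF// mul1r (szlenk_nat_eq0 (fin b0)); apply.
move=> g [Ag Ug]; rewrite /unit_ball/= -scalerBr rnormZ_real ?(ltW aV0)//.
by rewrite mulrC ler_pdivrMr// mul1r Ua//; exact: IH.
Qed.

Lemma szlenk_nat_exp a n : 0 < a -> (N (a ^+ n.+1) <= N a ^ n.+1)%N.
Proof.
move=> a0; elim: n => [|n IH]; first by rewrite expr1 expn1.
rewrite exprS expnS (leq_trans (szlenk_nat_submul a0 _)) ?exprn_gt0//.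
by rewrite leq_mul2l IH orbT.
Qed.

Lemma szlenk_nat_ge1 e : 0 < e -> 1 <= (N e)%:R :> R.
Proof. by move=> e0; rewrite ler1n szlenk_nat_gt0//; exact: fin. Qed.

Lemma ln_szlenk_nat_ge0 e : 0 < e -> 0 <= ln (N e)%:R :> R.
Proof. by move=> /szlenk_nat_ge1; exact: ln_ge0. Qed.

(** Submultiplicativity for a power of [e0] just below [e]; rounding the exponent up costs the
    [+ 1]. *)
Lemma ln_szlenk_nat_le e0 e : 0 < e0 < 1 -> 0 < e < 1 ->
  ln (N e)%:R <= (ln e / ln e0 + 1) * ln (N e0)%:R.
Proof.
move=> /andP[e00 e01] /andP[e_0 e_1].
have le0 : ln e0 < 0 by rewrite ln_lt0// e00.
have le : ln e < 0 by rewrite ln_lt0// e_0.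
have q0 : 0 <= ln e / ln e0 by rewrite ltW// nmulr_rgt0// invr_lt0.
have /andP[k1 k2] := truncn_itv q0; set k := Num.trunc _ in k1 k2.
have ek : e0 ^+ k.+1 <= e.
  rewrite -ler_ln ?posrE ?exprn_gt0// lnXn// -mulr_natr.
  by rewrite mulrC -ler_ndivrMr// ltW.
have Nk : ((N e)%:R <= (N e0)%:R ^+ k.+1 :> R).
  rewrite -natrX ler_nat (leq_trans (szlenk_nat_anti _ ek)) ?exprn_gt0//.
  exact: szlenk_nat_exp.
rewrite (@le_trans _ _ (ln ((N e0)%:R ^+ k.+1)))//.
  by rewrite ler_ln// posrE ?exprn_gt0// (lt_le_trans ltr01) ?szlenk_nat_ge1.
rewrite lnXn ?(lt_le_trans ltr01) ?szlenk_nat_ge1// -[leLHS]mulr_natl.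
by rewrite ler_wpM2r ?ln_szlenk_nat_ge0// -natr1 lerD2r.
Qed.

Let G e : R := ln (N e)%:R / `|ln e|.

Lemma near0_ln_gt (M : R) : \forall e \near 0^'+, M < - ln e.
Proof.
near=> e; have e0 : 0 < e by near: e; exact: nbhs_right_gt.
rewrite ltrNr -[ltRHS](expRK (- M)) ltr_ln ?posrE ?expR_gt0//.
by near: e; apply: nbhs_right_lt; exact: expR_gt0.
Unshelve. all: by end_near.
Qed.

Lemma near0_01 : \forall e \near (0 : R)^'+, 0 < e < 1.
Proof.
near=> e; have e0 : 0 < e by near: e; exact: nbhs_right_gt.
by rewrite e0/=; near: e; exact: nbhs_right_lt.
Unshelve. all: by end_near.
Qed.

(** Fekete's argument: the limit is the infimum of [G] over (0, 1), because [G e] exceeds [G e0] by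
    at most [ln (N e0) / |ln e|], which tends to 0 for fixed [e0]. *)
Lemma szlenk_power_type_cvg : G @ 0^'+ --> szlenk_power_type V.
Proof.
pose S := [set G e | e in [set e | 0 < e < 1]].
have G0 e : 0 < e < 1 -> 0 <= G e.
  by move=> /andP[e0 _]; rewrite /G divr_ge0 ?normr_ge0// ln_szlenk_nat_ge0.
have Sinf : has_inf S.
  split; first by exists (G 2^-1), 2^-1 => //=; rewrite invr_gt0 ltr0n invf_lt1// ltr1n.
  by exists 0 => _ [e e01 <-]; exact: G0.
suff h : G @ 0^'+ --> inf S by apply/cvg_ex; exists (inf S).
apply/cvgrPdist_lt => d d0.
have d20 : 0 < d / 2 by rewrite divr_gt0.
have [_ [e0 e001 <-] Ge0] := inf_adherent d20 Sinf.
have [e00 e01] := andP e001.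
have le0 : ln e0 < 0 by rewrite ln_lt0// e00.
near=> e.
have e_01 : 0 < e < 1 by near: e; exact: near0_01.
have lnNe : ln (N e0)%:R / (d / 2) < - ln e by near: e; exact: near0_ln_gt.
have le : ln e < 0 by rewrite ln_lt0.
have GL : inf S <= G e by apply: inf_lbound; [exact: Sinf.2|exists e].
rewrite distrC ger0_norm ?subr_ge0// ltrBlDl.
apply: (@le_lt_trans _ _ (G e0 + ln (N e0)%:R / - ln e)).
  rewrite /G !ltr0_norm// ler_pdivrMr ?oppr_gt0// (le_trans (ln_szlenk_nat_le e001 e_01))//.
  rewrite [leRHS]mulrDl divfK ?oppr_eq0 ?lt_eqF// mulrDl mul1r lerD2r.
  by rewrite invrN !mulrN !mulNr opprK mulrC mulrA [leRHS]mulrAC.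
rewrite [d]splitr addrA ltrD//.
by rewrite ltr_pdivrMr ?oppr_gt0// mulrC -ltr_pdivrMr.
Unshelve. all: by end_near.
Qed.

Lemma szlenk_power_type_ge0 : 0 <= szlenk_power_type V.
Proof.
apply: limr_ge; first by apply/cvg_ex; eexists; exact: szlenk_power_type_cvg.
near=> e; rewrite divr_ge0 ?normr_ge0// ln_szlenk_nat_ge0//.
Unshelve. all: by end_near.
Qed.

(** The constant only adds [ln C / |ln e|], which vanishes in the limit. *)
Lemma szlenk_power_type_le (C r : R) : 0 < C ->
  (\forall e \near 0^'+, (N e)%:R <= C * e `^ (- r)) -> szlenk_power_type V <= r.
Proof.
move=> C0 NC; apply/ler_addgt0Pr => d d0.
apply: limr_le; first by apply/cvg_ex; eexists; exact: szlenk_power_type_cvg.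
near=> e.
have /andP[e0 e1] : 0 < e < 1 by near: e; exact: near0_01.
have le : ln e < 0 by rewrite ln_lt0// e0.
have lC : `|ln C| / d < - ln e by near: e; exact: near0_ln_gt.
have Ne : (N e)%:R <= C * e `^ (- r) by near: e; exact: NC.
rewrite ltr0_norm// ler_pdivrMr ?oppr_gt0//.
apply: (@le_trans _ _ (ln (C * e `^ (- r)))).
  by rewrite ler_ln// posrE ?mulr_gt0 ?powR_gt0// (lt_le_trans ltr01) ?szlenk_nat_ge1.
rewrite lnM ?posrE ?powR_gt0// ln_powR.
have : ln C <= d * - ln e.
  by rewrite (le_trans (ler_norm _))// mulrC -ler_pdivrMr// ltW.
lra.
Unshelve. all: by end_near.
Qed.

Lemma szlenk_power_type_ge (c r : R) : 0 < c ->
  (\forall e \near 0^'+, c * e `^ (- r) <= (N e)%:R) -> r <= szlenk_power_type V.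
Proof.
move=> c0 Nc; apply/ler_addgt0Pr => d d0; rewrite -lerBlDr.
apply: limr_ge; first by apply/cvg_ex; eexists; exact: szlenk_power_type_cvg.
near=> e.
have /andP[e0 e1] : 0 < e < 1 by near: e; exact: near0_01.
have le : ln e < 0 by rewrite ln_lt0// e0.
have lC : `|ln c| / d < - ln e by near: e; exact: near0_ln_gt.
have Ne : c * e `^ (- r) <= (N e)%:R by near: e; exact: Nc.
rewrite ltr0_norm// ler_pdivlMr ?oppr_gt0//.
apply: (@le_trans _ _ (ln (c * e `^ (- r)))); last first.
  by rewrite ler_ln// posrE ?mulr_gt0 ?powR_gt0// (lt_le_trans ltr01) ?szlenk_nat_ge1.
rewrite lnM ?posrE ?powR_gt0// ln_powR.
have : - ln c <= d * - ln e.
  apply: (@le_trans _ _ `|ln c|); first by rewrite -normrN ler_norm.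
  by rewrite mulrC -ler_pdivrMr// ltW.
lra.
Unshelve. all: by end_near.
Qed.

(** Near 0 the limit gives the bound with constant 1; away from 0 the index is at most its value at
    a fixed [e2], which serves as the constant. *)
Lemma szlenk_nat_le_powR (r : R) : szlenk_power_type V < r ->
  exists2 C, 0 < C & forall e, 0 < e <= 1 -> (N e)%:R <= C * e `^ (- r).
Proof.
move=> pr; have r0 : 0 < r by exact: le_lt_trans szlenk_power_type_ge0 pr.
have : \forall e \near 0^'+, G e < r by exact: cvgr_lt szlenk_power_type_cvg _ pr.
rewrite /at_right near_withinE => /nbhs_norm0P[e1 /= e10 Ge1].
pose e2 := Num.min e1 1 / 2.
have m0 : 0 < Num.min e1 1 by rewrite lt_min e10 ltr01.
have e20 : 0 < e2 by rewrite divr_gt0.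
exists (N e2)%:R; first by rewrite (lt_le_trans ltr01)// szlenk_nat_ge1.
move=> e /andP[e0 e_1].
have p1 : 1 <= e `^ (- r).
  rewrite powRN -invr1 lef_pV2 ?posrE ?powR_gt0//.
  have r1 : 1 = 1 `^ r :> R by rewrite powR1.
  by rewrite [leRHS]r1 ge0_ler_powR ?nnegrE ?(ltW r0) ?(ltW e0) ?ler01.
have [ee|ee] := leP e2 e.
  apply: (@le_trans _ _ (N e2)%:R); first by rewrite ler_nat szlenk_nat_anti.
  by rewrite ler_peMr ?ler0n.
have e2m : e2 < Num.min e1 1 by rewrite ltr_pdivrMr// ltr_pMr// ltr1n.
have [ee1 ee2] : e < e1 /\ e < 1.
  by apply/andP; rewrite -lt_min (lt_trans ee).
have := Ge1 e; rewrite /= gtr0_norm// => /(_ ee1 e0).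
have le : ln e < 0 by rewrite ln_lt0// e0.
rewrite /G ltr0_norm// ltr_pdivrMr ?oppr_gt0// mulrN -mulNr -ln_powR => h.
have {}h : (N e)%:R < e `^ (- r).
  by rewrite -ltr_ln ?posrE ?powR_gt0// (lt_le_trans ltr01)// szlenk_nat_ge1.
rewrite (le_trans (ltW h))// ler_peMl ?powR_ge0//; exact: szlenk_nat_ge1.
Qed.

End power_type.

(** * Composition of operators and complemented subspaces *)

Section composition.
Context (R : realType) (s : scalars).
Local Notation K := (scalar_field R s).
Context (U V W : normedModType K).

Lemma bounded_op_comp_linear (S : bounded_op V W) (T : bounded_op U V) : linear (S \o T).
Proof. by move=> a x y; rewrite /= !bounded_op_linear. Qed.

Lemma bounded_op_comp_bound (S : bounded_op V W) (T : bounded_op U V) x :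
  rnorm ((S \o T) x) <= (rnorm S * rnorm T) * rnorm x.
Proof.
rewrite /= (le_trans (ler_rnorm_op _ _))// -mulrA ler_wpM2l ?rnorm_ge0//.
exact: ler_rnorm_op.
Qed.

Definition bounded_op_comp (S : bounded_op V W) (T : bounded_op U V) : bounded_op U W :=
  bounded_op_of (bounded_op_comp_linear S T) (bounded_op_comp_bound S T).

Lemma rnorm_bounded_op_comp S T : rnorm (bounded_op_comp S T) <= rnorm S * rnorm T.
Proof. by apply: rnorm_bounded_op_of; rewrite mulr_ge0 ?rnorm_ge0. Qed.

End composition.

Section complemented.
Context (R : realType) (s : scalars).
Local Notation K := (scalar_field R s).
Context (V W : normedModType K) (P : bounded_op W V) (J : bounded_op V W).
Hypothesis PJ : forall v, P (J v) = v.

(** The scaled adjoint of [P] maps the dual ball of [V] into that of [W]; composing with [J] undoes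
    it, so it shrinks distances by a bounded factor at most. *)
Lemma szlenk_nat_complemented : finite_szlenk W ->
  exists2 c, 0 < c & forall e, 0 < e -> (szlenk_nat V e <= szlenk_nat W (c * e))%N.
Proof.
(* The [+ 1] keeps both constants positive when the operators vanish. *)
move=> finW; pose M := rnorm P + 1; pose M' := rnorm J + 1.
have M0 : 0 < M by rewrite ltr_wpDl ?rnorm_ge0.
have M'0 : 0 < M' by rewrite ltr_wpDl ?rnorm_ge0.
have MV0 : 0 < M^-1 by rewrite invr_gt0.
have c0 : 0 < (M * M')^-1 by rewrite invr_gt0 mulr_gt0.
exists (M * M')^-1 => // e e0; apply: szlenk_nat_le; rewrite -subset0.
pose t (f : dual V) : dual W := of_real s M^-1 *: (bounded_op_comp f P : dual W).
move=> f fn.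
suff : szlenk_n ((M * M')^-1 * e) (unit_ball (V := dual W))
    (szlenk_nat W ((M * M')^-1 * e)) (t f).
  by rewrite szlenk_nat_eq0//; apply: finW; rewrite mulr_gt0.
apply: (szlenk_n_transfer c0 _ _ _ fn) => [w|g h|g].
- move=> g; exact: (cvgZl_tmp (k := of_real s M^-1) (@weak_star_eval_continuous R s V (P w) g)).
- rewrite mulrC ler_pdivrMr ?mulr_gt0//; apply: rnorm_op_le => v v1.
  have -> : (g - h) v = of_real s M *: ((t g - t h) (J v) : K^o).
    rewrite -scalerBr -[RHS]/(of_real s M *: (of_real s M^-1 *: ((g (P (J v)) - h (P (J v))) : K^o))).
    by rewrite scalerA -of_realM mulfV ?gt_eqF// of_real1 scale1r PJ.
  rewrite rnormZ_real ?(ltW M0)// mulrCA ler_wpM2l ?(ltW M0)//.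
  rewrite (le_trans (ler_rnorm_op _ _))// ler_wpM2l ?rnorm_ge0//.
  rewrite (le_trans (ler_rnorm_op _ _))// (@le_trans _ _ (rnorm J))//.
    by rewrite ler_piMr ?rnorm_ge0.
  by rewrite lerDl.
- rewrite /unit_ball/= => g1; rewrite rnormZ_real ?(ltW MV0)// mulrC ler_pdivrMr// mul1r.
  rewrite (le_trans (rnorm_bounded_op_comp _ _))// (@le_trans _ _ (rnorm P))//.
    by rewrite ler_piMl ?rnorm_ge0.
  by rewrite lerDl.
Qed.

Lemma szlenk_power_type_complemented : finite_szlenk V -> finite_szlenk W ->
  szlenk_power_type V <= szlenk_power_type W.
Proof.
move=> finV finW; apply/ler_addgt0Pr => d d0.
have [c c0 VW] := szlenk_nat_complemented finW.
have pd : szlenk_power_type W < szlenk_power_type W + d by rewrite ltrDl.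
set r := _ + d in pd *.
have [C C0 NC] := szlenk_nat_le_powR finW pd.
apply: (@szlenk_power_type_le _ _ _ finV (C * c `^ (- r))).
  by rewrite mulr_gt0 ?powR_gt0.
near=> e.
have e0 : 0 < e by near: e; exact: nbhs_right_gt.
rewrite (@le_trans _ _ (szlenk_nat W (c * e))%:R) ?ler_nat ?VW//.
rewrite -mulrA -powRM ?(ltW c0) ?(ltW e0)//; apply: NC.
rewrite mulr_gt0//= mulrC -ler_pdivlMr// mul1r.
by near: e; apply: nbhs_right_le; rewrite invr_gt0.
Unshelve. all: by end_near.
Qed.

End complemented.

(** * A power type is at least 1, or the first derivatives are empty *)

Section dichotomy.
Context (R : realType) (s : scalars).
Local Notation K := (scalar_field R s).
Context (V : normedModType K).
Local Notation B := (unit_ball (V := dual V)).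
Hypothesis fin : finite_szlenk V.

(** Convexity: weight [t] is moved from [y] to [x], one portion at a time. Varying one portion over
    the ball gives an affine copy of it, scaled by [t], whose point over [x] survives one more
    derivation of order [t * e0]. *)
Lemma szlenk_n_linear_growth (e0 t : R) (x y : dual V) n :
  szlenk_derivation e0 B x -> 0 < t -> n%:R * t <= 1 -> B y ->
  szlenk_n (t * e0) B n (of_real s (1 - n%:R * t) *: y + of_real s (n%:R * t) *: x).
Proof.
move=> xe t0; elim: n y => [|n IH] y nt y1.
  by rewrite mul0r subr0 of_real0 of_real1 scale1r scale0r addr0.
have nt1 : 0 < 1 - n%:R * t.
  by rewrite subr_gt0 (lt_le_trans _ nt)// ltr_pM2r// ltr_nat.
pose f0 := of_real s (1 - n.+1%:R * t) *: y + of_real s (n%:R * t) *: x.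
have -> : of_real s (1 - n.+1%:R * t) *: y + of_real s (n.+1%:R * t) *: x =
    of_real s t *: x + f0.
  by rewrite /f0 addrCA -scalerDl -of_realD -natr1 mulrDl mul1r (addrC t).
apply: (@szlenk_n_affine _ _ V t f0 e0 B (szlenk_n (t * e0) B n) 1%N x t0 _ xe).
(* [y'] renormalizes the part of the combination not carried by [x]; it lies in the ball by
   convexity, so the induction hypothesis applies to it. *)
move=> g g1; pose y' := of_real s ((1 - n%:R * t)^-1) *:
  (of_real s t *: g + of_real s (1 - n.+1%:R * t) *: y).
have -> : of_real s t *: g + f0 = of_real s (1 - n%:R * t) *: y' + of_real s (n%:R * t) *: x.
  by rewrite /y' scalerA -of_realM mulfV ?gt_eqF// of_real1 scale1r addrA.
apply: IH; first by rewrite -subr_ge0 ltW.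
rewrite /unit_ball/= rnormZ_real ?invr_ge0 ?(ltW nt1)// mulrC ler_pdivrMr// mul1r.
rewrite (le_trans (ler_rnormD _ _))// !rnormZ_real ?subr_ge0// ?(ltW t0)//.
have h1 : t * rnorm g <= t by rewrite ler_piMr// ltW.
have h2 : (1 - n.+1%:R * t) * rnorm y <= 1 - n.+1%:R * t.
  by rewrite ler_piMr// subr_ge0.
by apply: (le_trans (lerD h1 h2)); rewrite -natr1; lra.
Qed.

(** A single point surviving one derivation of order [e0] forces an index of at least [e0 / e] at
    small [e], by linear growth with [t = e / e0]. *)
Lemma szlenk_power_type_ge1 :
  1 <= szlenk_power_type V \/ forall e, 0 < e -> szlenk_n e B 1 = set0.
Proof.
have [|] := pselect (forall e, 0 < e -> szlenk_n e B 1 = set0); first by right.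
move=> /existsNP[e0 /not_implyP[e00 /eqP/set0P[x xe]]]; left.
apply: (@szlenk_power_type_ge _ _ _ fin e0) => //; near=> e.
have e_0 : 0 < e by near: e; exact: nbhs_right_gt.
have ee0 : e <= e0 by near: e; exact: nbhs_right_le.
rewrite powRN powRr1 ?(ltW e_0)//.
pose t := e / e0; have t0 : 0 < t by rewrite divr_gt0.
have te : t * e0 = e by rewrite divfK ?gt_eqF.
have q0 : 0 <= e0 / e by rewrite divr_ge0 ?ltW.
have /andP[k1 k2] := truncn_itv q0; set k := Num.trunc _ in k1 k2.
rewrite (le_trans (ltW k2))// ler_nat ltnNge; apply/negP => Nk.
have kt : k%:R * t <= 1.
  by rewrite /t mulrA ler_pdivrMr// mul1r -ler_pdivlMr.
have := szlenk_n_linear_growth xe t0 kt (unit_ball0 V).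
move=> /(szlenk_n_decr Nk); rewrite te szlenk_nat_eq0//; exact: fin.
Unshelve. all: by end_near.
Qed.

Lemma szlenk_power_type_eq0 : (forall e, 0 < e -> szlenk_n e B 1 = set0) ->
  szlenk_power_type V = 0.
Proof.
move=> h; apply/eqP; rewrite eq_le szlenk_power_type_ge0// andbT.
apply: (@szlenk_power_type_le _ _ _ fin 1) => //; near=> e.
have e_0 : 0 < e by near: e; exact: nbhs_right_gt.
rewrite oppr0 powRr0 mulr1 -[leRHS]/(1%:R) ler_nat.
by apply: szlenk_nat_le; exact: h.
Unshelve. all: by end_near.
Qed.

End dichotomy.

(** * Weakly null trees *)

Section trees.
Context (R : realType) (s : scalars).
Local Notation K := (scalar_field R s).
Context (V : normedModType K).
Implicit Types (e c t : R) (f g : dual V) (z : V).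
Local Notation B := (unit_ball (V := dual V)).
Local Notation re := (@to_real R s).

(** A filter in the role of a weakly null net. *)
Definition weakly_null (F : set_system V) :=
  forall g e, 0 < e -> \forall z \near F, rnorm (g z) < e.

(* There is a weakly null tree of height n in the unit ball, rooted at z, along
   each branch of which the sum (z included) has norm greater than c. *)
Fixpoint large_tree c n z : Prop :=
  match n with
  | 0%N => c < rnorm z
  | m.+1 => exists F : set_system V, [/\ ProperFilter F, weakly_null F &
      \forall x \near F, rnorm x <= 1 /\ large_tree c m (z + x)]
  end.

Lemma rnorm_dual_gt f c : c < rnorm f -> exists2 z, rnorm z <= 1 & c < re (f z).
Proof.
move=> /rnorm_op_gt[z z1 cz]; have [u u1 uz] := phase (f z).
exists (u *: z); last by rewrite bounded_opZ -[_ *: _]/(u * f z) uz of_realK.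
by rewrite rnormZ (le_trans _ z1)// ler_piMl ?rnorm_ge0.
Qed.

(** A filter controls its pairs only on one of its members, while limits along ultrafilters are
    taken of functions bounded everywhere; this cut-off provides the bound. *)
Let unit_part z := if rnorm z <= 1 then z else 0.

Let rnorm_unit_part z : rnorm (unit_part z) <= 1.
Proof. by rewrite /unit_part; case: ifP => //; rewrite rnorm0 ler01. Qed.

(** Of two points more than [e] apart, one is more than [e / 2] away from [f], and a vector of the
    ball witnesses this. Such pairs exist over every neighborhood of [f], so they carry a filter. *)
Lemma szlenk_derivation_ultra e A f : szlenk_derivation e A f ->
  exists F : set_system (dual V * V), [/\ UltraFilter F,
    forall v, ((i : dual V * V).1 v : K^o) @[i --> F] --> (f v : K^o) &
    \forall i \near F, [/\ A i.1, rnorm i.2 <= 1 & e / 2 < re ((i.1 - f) i.2)]].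
Proof.
move=> /szlenk_derivationP[Af h].
pose S (U : set (weak_star V)) := [set i : dual V * V | U i.1 /\
  [/\ A i.1, rnorm i.2 <= 1 & e / 2 < re ((i.1 - f) i.2)]].
pose D := [set U : set (weak_star V) | open U /\ U f].
have FF : ProperFilter (filter_from D S).
  apply: filter_from_proper; last first.
    move=> U [oU Uf]; have [g1 [g2 [A1 A2 U1 U2 e12]]] := h _ oU Uf.
    have [g [Ag Ug eg]] : exists g, [/\ A g, U g & e / 2 < rnorm (g - f)].
      have [e1|] := boolP (e / 2 < rnorm (g1 - f : dual V)).
        by exists g1; split; [exact: A1|exact: U1|exact: e1].
      rewrite -leNgt => e1; exists g2; split; [exact: A2|exact: U2|rewrite ltNge; apply/negP => e2].
      have := ler_rnorm_dist g1 f g2; rewrite (rnorm_distC f) => h12.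
      have := lt_le_trans e12 (le_trans h12 (lerD e1 e2)).
      by rewrite -splitr ltxx.
    by have [z z1 ez] := rnorm_dual_gt eg; exists (g, z).
  apply: filter_from_filter; first by exists setT; split => //; exact: openT.
  move=> U U' [oU Uf] [oU' U'f]; exists (U `&` U').
    by split => //; exact: openI.
  by move=> i [[Ui U'i] Ai]; split.
have [F [UF FF0]] := ultraFilterLemma FF.
exists F; split => //.
- move=> v; apply/cvg_rnormP => d d0.
  have := @weak_star_eval_continuous _ _ V v f.
  move=> /(cvg_rnormP _ _)/(_ d d0); rewrite nbhsE => -[U [oU Uf] Ud].
  by apply: FF0; exists U => // i [Ui _]; exact: Ud.
- by apply: FF0; exists setT; [split => //; exact: openT|move=> i []].
Qed.

(* The differences (z' - z) / 2 of almost norming vectors z, z', along the product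
   of an ultrafilter by itself, are weakly null. *)
Lemma large_tree_szlenk e n f t z : 0 < e -> szlenk_n e B n f -> t < re (f z) ->
  large_tree (t + n%:R * (e / 5)) n z.
Proof.
move=> e0; elim: n f t z => [|n IH] f t z fn tz.
  rewrite /= mul0r addr0 (lt_le_trans tz)// (le_trans (ler_to_real _))//.
  by rewrite (le_trans (ler_rnorm_op _ _))// ler_piMl ?rnorm_ge0.
have [F [UF Ff FA]] := szlenk_derivation_ultra (fn : szlenk_derivation e (szlenk_n e B n) f).
pose d (i j : dual V * V) := of_real s 2^-1 *: (unit_part j.2 - unit_part i.2).
have half0 : (0 : R) <= 2^-1 by rewrite invr_ge0.
have d1 i j : rnorm (d i j) <= 1.
  rewrite /d rnormZ_real// mulrC ler_pdivrMr// mul1r (le_trans (ler_rnormB _ _))//.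
  by rewrite -[leRHS]/(1 + 1) lerD.
(* The image under [d] of the product of [F] with itself: [j] is chosen after [i], so it may be
   taken close to [f] on the vector of [i]. *)
pose G (P : set V) := \forall i \near F, \forall j \near F, P (d i j).
have GF : ProperFilter G.
  apply: Build_ProperFilter_ex => [P GP|].
    have /filter_ex[i /filter_ex[j Pij]] : \forall i \near F, \forall j \near F, P (d i j) by [].
    by exists (d i j).
  split.
  - by change (\forall i \near F, \forall j \near F, setT (d i j)); apply: nearW => i; apply: nearW.
  - move=> P Q; apply: (@filterS2 _ F _ (fun i => \forall j \near F, P (d i j)) (fun i => \forall j \near F, Q (d i j)) (fun i => \forall j \near F, (P `&` Q) (d i j))) => i; exact: filterI.
  - move=> P Q PQ; apply: (@filterS _ F _ (fun i => \forall j \near F, P (d i j)) (fun i => \forall j \near F, Q (d i j))) => i; apply: filterS => j; exact: PQ.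
have Gnull : weakly_null G.
  move=> g eta eta0.
  have gb (i : dual V * V) : rnorm (g (unit_part i.2) : K^o) <= rnorm g.
    by rewrite (le_trans (ler_rnorm_op _ _))// ler_piMr ?rnorm_ge0.
  have [l /cvg_rnormP gl] := @ultra_bounded_scalar R s _ F (fun i : dual V * V => g (unit_part i.2)) _ UF gb.
  have {}gl := gl _ eta0.
  change (\forall i \near F, \forall j \near F, rnorm (g (d i j)) < eta); near=> i; near=> j.
  rewrite /d bounded_opZ rnormZ_real// mulrC ltr_pdivrMr// bounded_opB.
  rewrite (le_lt_trans (ler_rnorm_dist _ l _))// (rnorm_distC l).
  rewrite mulrDr mulr1 ltrD//; [near: j|near: i]; exact: gl.
exists G; split => //.
(* With errors below [e / 40], the gain is more than [(e / 2 - e / 40) / 2 - e / 40 = 17 e / 80],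
   which exceeds [e / 5]. *)
have e40 : 0 < e / 40 by rewrite divr_gt0.
have : \forall i \near F, \forall j \near F, rnorm (f (d i j) : K^o) < e / 40 by exact: Gnull.
change ((\forall i \near F, \forall j \near F, rnorm (f (d i j) : K^o) < e / 40) ->
  \forall i \near F, \forall j \near F, rnorm (d i j) <= 1 /\
    large_tree (t + n.+1%:R * (e / 5)) n (z + d i j)).
apply: filterS => i Gi.
have tz' : 0 < re (f z) - t by rewrite subr_gt0.
near=> j; split => //.
have dj : rnorm (f (d i j)) < e / 40 by near: j; exact: Gi.
have [Aj j1 ej] : [/\ szlenk_n e B n j.1, rnorm j.2 <= 1 & e / 2 < re ((j.1 - f) j.2)].
  by near: j; exact: FA.
have fj : rnorm (j.1 (unit_part i.2) - f (unit_part i.2) : K^o) < e / 40.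
  by near: j; have /cvg_rnormP h := Ff (unit_part i.2); exact: h.
have tj : t < re (j.1 z).
  have : rnorm (j.1 z - f z : K^o) < re (f z) - t.
    by near: j; have /cvg_rnormP h := Ff z; exact: h.
  move=> /(le_lt_trans (ler_norm_to_real _)); rewrite to_realB ltr_norml => /andP[+ _].
  by rewrite opprB ltrBDr subrK.
rewrite (_ : t + _ = t + e / 5 + n%:R * (e / 5)); last by rewrite -natr1; ring.
(* The functional [j.1] takes over from [f]: it lies in the n-th derivative, still exceeds [t] at
   [z], and gains [e / 5] on the new node. *)
apply: (IH _ _ _ Aj); rewrite bounded_opD to_realD ltrD//.
have jd : j.1 (d i j) = of_real s 2^-1 * ((j.1 - f) j.2 - (j.1 (unit_part i.2) - f (unit_part i.2))) + f (d i j).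
  rewrite /d /(unit_part j.2) j1 !bounded_opZ !bounded_opB.
  rewrite -![_ *: _]/(of_real s 2^-1 * _) -mulrDr; congr (_ * _).
  by rewrite -[(j.1 - f) j.2]/(j.1 j.2 - f j.2) opprB; set a := j.1 j.2; set b := f j.2; set c := j.1 _; set d0 := f _; clearbody a b c d0; clear; move: a b c d0; rewrite /GRing.regular => a b c d0; ring.
rewrite jd to_realD to_realMl to_realB.
have h1 := le_lt_trans (ler_norm_to_real _) fj.
have h2 := le_lt_trans (ler_norm_to_real _) dj.
move: h1 h2; rewrite !ltr_norml => /andP[_ h1] /andP[h2 _].
by lra.
Unshelve. all: by end_near.
Qed.

End trees.

(** * The Hahn-Banach theorem *)

Section hahn_banach.
Context (R : realType) (s : scalars).
Local Notation K := (scalar_field R s).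
Context (V : normedModType K).
Implicit Types (x y v : V) (a b c : R) (G : set (V * R)).
Local Notation "a *r x" := (of_real s a *: x) (at level 40).

(* G is the graph of a real-linear functional on a real subspace of V, dominated
   by the norm; it is empty or contains (y, |y|). *)
Let norming_graph y G := [/\
  forall u w, G u -> G w -> G (u.1 + w.1, u.2 + w.2),
  forall a u, G u -> G (a *r u.1, a * u.2),
  forall u, G u -> u.2 <= rnorm u.1 &
  G !=set0 -> G (y, rnorm y)].

Let real_span y := [set (a *r y, a * rnorm y) | a in [set: R]].

Let real_span_norming y : norming_graph y (real_span y).
Proof.
split.
- move=> _ _ [a _ <-] [b _ <-]; exists (a + b) => //=.
  by rewrite of_realD scalerDl mulrDl.
- by move=> c _ [a _ <-]; exists (c * a) => //=; rewrite of_realM scalerA mulrA.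
- move=> _ [a _ <-] /=; have [a0|a0] := leP 0 a; first by rewrite rnormZ_real.
  by rewrite (le_trans _ (rnorm_ge0 _))// nmulr_rle0// rnorm_ge0.
- by move=> _; exists 1 => //; rewrite of_real1 scale1r mul1r.
Qed.

(** The value at [v] must lie above all [u.2 - |u.1 - v|] and below all [|w.1 + v| - w.2]; the
    triangle inequality makes the supremum of the former admissible. Homogeneity reduces other
    multiples of [v] to the coefficients 1 and -1. *)
Let one_step y G v : norming_graph y G -> G (y, rnorm y) ->
  exists r, norming_graph y (G `|` [set w | exists c u, G u /\ w = (u.1 + c *r v, u.2 + c * r)]).
Proof.
move=> [GD GZ Gn Gy] yG.
pose S := [set u.2 - rnorm (u.1 - v) | u in G].
have ubS w : G w -> ubound S (rnorm (w.1 + v) - w.2).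
  move=> Gw _ [u Gu <-]; have h1 := Gn _ (GD _ _ Gu Gw).
  have h2 : rnorm (u.1 + w.1) <= rnorm (u.1 - v) + rnorm (w.1 + v).
    by rewrite (le_trans _ (ler_rnormD _ _))// addrACA addNr addr0.
  by rewrite /= in h1; lra.
have supS : has_sup S.
  split; first by exists (rnorm y - rnorm (y - v)), (y, rnorm y).
  by exists (rnorm (y + v) - rnorm y); exact: (ubS _ yG).
pose r := sup S; exists r.
have r1 u : G u -> u.2 - r <= rnorm (u.1 - v).
  move=> Gu; rewrite lerBlDr -lerBlDl; apply: sup_upper_bound => //.
  by exists u.
have r2 u : G u -> u.2 + r <= rnorm (u.1 + v).
  by move=> Gu; rewrite -lerBrDl; apply: ge_sup; [exact: supS.1|exact: ubS].
have dom u c : G u -> u.2 + c * r <= rnorm (u.1 + c *r v).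
  move=> Gu; have [c0|c0|->] := ltgtP c 0; last first.
  - by rewrite mul0r of_real0 scale0r !addr0 Gn.
  - have /(ler_wpM2l (ltW c0)) := r2 _ (GZ c^-1 _ Gu).
    rewrite /= mulrDr mulrA mulfV ?gt_eqF// mul1r -rnormZ_real ?(ltW c0)//.
    by rewrite scalerDr scalerA -of_realM mulfV ?gt_eqF// of_real1 scale1r.
  - have d0 : 0 < - c by rewrite oppr_gt0.
    rewrite -(opprK c); move: (- c) d0 => d d0.
    have /(ler_wpM2l (ltW d0)) := r1 _ (GZ d^-1 _ Gu).
    rewrite /= mulrBr mulrA mulfV ?gt_eqF// mul1r -rnormZ_real ?(ltW d0)//.
    by rewrite scalerBr scalerA -of_realM mulfV ?gt_eqF// of_real1 scale1r of_realN scaleNr mulNr.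
have Gsub u : G u -> exists c w, G w /\ u = (w.1 + c *r v, w.2 + c * r).
  by move=> Gu; exists 0, u; split => //; rewrite of_real0 scale0r mul0r !addr0; case: u {Gu}.
split.
- move=> u w hu hw; right.
  have [c [u' [Gu ->]]] : exists c u', G u' /\ u = (u'.1 + c *r v, u'.2 + c * r).
    by case: hu => //; exact: Gsub.
  have [d [w' [Gw ->]]] : exists c u', G u' /\ w = (u'.1 + c *r v, u'.2 + c * r).
    by case: hw => //; exact: Gsub.
  exists (c + d), (u'.1 + w'.1, u'.2 + w'.2); split; first exact: GD.
  by rewrite /= of_realD scalerDl mulrDl; congr pair; rewrite addrACA.
- move=> a u hu; right.
  have [c [u' [Gu ->]]] : exists c u', G u' /\ u = (u'.1 + c *r v, u'.2 + c * r).
    by case: hu => //; exact: Gsub.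
  exists (a * c), (a *r u'.1, a * u'.2); split; first exact: GZ.
  by rewrite /= of_realM scalerDr scalerA mulrDr mulrA.
- by move=> u [|[c [w [Gw ->]]]]; [exact: Gn|exact: dom].
- by move=> _; left.
Qed.

Lemma real_norming_functional y : exists u : V -> R, [/\
  {morph u : x z / x + z}, forall a x, u (a *r x) = a * u x,
  forall x, u x <= rnorm x & u y = rnorm y].
Proof.
(* The empty chain has the empty graph as its union, which is why [norming_graph] admits it;
   maximality excludes it afterwards. *)
have [|G [Gn Gmax]] := @Zorn_bigcup (V * R)%type [set G | norming_graph y G].
  move=> F FP Ftot; split.
  - move=> u v [X FX Xu] [Y FY Yv].
    have [XY|YX] := Ftot _ _ FX FY.
      by exists Y => //; have [h _ _ _] := FP _ FY; apply: h => //; exact: XY.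
    by exists X => //; have [h _ _ _] := FP _ FX; apply: h => //; exact: YX.
  - by move=> a u [X FX Xu]; exists X => //; have [_ h _ _] := FP _ FX; exact: h.
  - by move=> u [X FX Xu]; have [_ _ h _] := FP _ FX; exact: h.
  - by move=> [u [X FX Xu]]; exists X => //; have [_ _ _ h] := FP _ FX; apply: h; exists u.
have yG : G (y, rnorm y).
  have [[u Gu]|G0] := pselect (G !=set0); first by have [_ _ _ h] := Gn; apply: h; exists u.
  exfalso; apply: (Gmax (real_span y) _ (real_span_norming y)).
  split; first by move=> u Gu; case: G0; exists u.
  move=> /(_ (y, rnorm y)) h; apply: G0; exists (y, rnorm y); apply: h.
  by exists 1 => //; rewrite of_real1 scale1r mul1r.
have Gtot v : exists r, G (v, r).
  have [r Pr] := one_step v Gn yG.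
  apply: contrapT => nv; apply: (Gmax _ _ Pr); split; first by move=> u; left.
  move=> /(_ (v, r)) h; apply: nv; exists r; apply: h; right.
  have [_ GZ _ _] := Gn; exists 1, (0, 0); split.
    by have := GZ 0 _ yG; rewrite of_real0 scale0r mul0r.
  by rewrite /= of_real1 scale1r mul1r !add0r.
have [GD GZ Gle _] := Gn.
(* Domination forces single values: the difference of two values at [v] is a value at 0, hence at
   most 0. *)
have Guniq v a b : G (v, a) -> G (v, b) -> a = b.
  move=> Ga Gb; apply/eqP; rewrite -subr_eq0.
  have h (c d : R) : G (v, c) -> G (v, d) -> c - d <= 0.
    move=> Gc Gd; have := GZ (-1) _ Gd; rewrite /= of_realN of_real1 scaleN1r mulN1r.
    by move=> /(GD _ _ Gc)/Gle; rewrite /= subrr rnorm0.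
  by rewrite eq_le h//= -oppr_le0 opprB h.
have [u Gu] := choice Gtot.
exists u; split.
- by move=> x z; apply: (Guniq (x + z)) => //; exact: GD (Gu x) (Gu z).
- by move=> a x; apply: (Guniq (a *r x)) => //; exact: GZ (Gu x).
- by move=> x; exact: Gle (Gu x).
- exact: Guniq (Gu y) yG.
Qed.

End hahn_banach.

(** In the complex case, the Bohnenblust-Sobczyk formula [h x = u x - i u (i x)]. *)
Lemma real_part_functional (R : realType) (s : scalars)
    (V : normedModType (scalar_field R s)) (u : V -> R) :
  {morph u : x z / x + z} -> (forall a x, u (of_real s a *: x) = a * u x) ->
  exists2 h : V -> (scalar_field R s)^o, linear h & forall x, to_real (h x) = u x.
Proof.
case: s V u => V u uD uZ.
  by exists u => // a x y; rewrite uD uZ.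
have uN x : u (- x) = - u x.
  by have := uZ (-1) x; rewrite of_realN of_real1 scaleN1r mulN1r.
pose h x : R[i] := (u x +i* - u ('i%C *: x))%C.
exists h => // a x y.
have uI z b : u ((b *i)%C *: z) = b * u ('i%C *: z).
  have -> : (b *i)%C = b%:C%C * 'i%C :> R[i] by simpc.
  by rewrite -scalerA; exact: uZ.
have uRI z b c : u ((b +i* c)%C *: z) = b * u z + c * u ('i%C *: z).
  have -> : (b +i* c)%C = b%:C%C + (c *i)%C :> R[i] by simpc.
  by rewrite scalerDl uD uI; congr (_ + _); exact: uZ.
case: a => b c; rewrite /h -[RHS]/((b +i* c)%C * _ + _) scalerDr !uD.
rewrite scalerA.
have -> : 'i%C * (b +i* c)%C = (- c +i* b)%C :> R[i] by simpc.
rewrite (uRI x b c) (uRI x (- c) b); move: (u x) (u y) (u ('i%C *: x)) (u ('i%C *: y)) => p q p' q'.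
by apply/eqP; rewrite eq_complex; apply/andP; split; apply/eqP; rewrite /=; ring.
Qed.

Lemma norming_functional (R : realType) (s : scalars)
    (V : normedModType (scalar_field R s)) (y : V) :
  exists2 h : dual V, rnorm h <= 1 & to_real (h y : scalar_field R s) = rnorm y.
Proof.
have [u [uD uZ uN uy]] := real_norming_functional y.
have [h lh hu] := real_part_functional uD uZ.
have hb x : rnorm (h x) <= 1 * rnorm x.
  rewrite mul1r; apply: rnorm_to_real_sup => w w1.
  have h0 : h 0 = 0 by have := lh (-1) 0 0; rewrite scaler0 addr0 scaleN1r addNr.
  have -> : w * h x = h (w *: x) by rewrite -[w *: x]addr0 lh h0 addr0.
  by rewrite hu (le_trans (uN _))// rnormZ ler_piMl ?rnorm_ge0.
by exists (bounded_op_of lh hb); [exact: rnorm_bounded_op_of|rewrite /= hu uy].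
Qed.

(** * Spaces of compact operators *)

Section compact_trees.
Context (R : realType) (s : scalars).
Local Notation K := (scalar_field R s).
Context (X Y : normedModType K).
Local Notation Z := (compact_op X Y).
Implicit Types (g : dual (dual X)) (h : dual Y) (T : Z).
Local Notation re := (@to_real R s).

Lemma adjoint_linear h : linear (fun T : Z => bounded_op_comp h T : dual X).
Proof.
move=> a S T; apply/val_inj/funext => x /=.
by rewrite -[RHS]/(a *: h (S x) + h (T x)) -bounded_op_linear.
Qed.

Definition pair_eval g h T : K^o := g (bounded_op_comp h T).

Lemma pair_eval_linear g h : linear (pair_eval g h).
Proof. by move=> a S T; rewrite /pair_eval adjoint_linear bounded_op_linear. Qed.

Lemma rnorm_pair_eval g h T : rnorm (pair_eval g h T) <= rnorm g * rnorm h * rnorm T.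
Proof.
rewrite (le_trans (ler_rnorm_op _ _))// -mulrA ler_wpM2l ?rnorm_ge0//.
exact: rnorm_bounded_op_comp.
Qed.

Definition pair_dual g h : dual Z :=
  bounded_op_of (pair_eval_linear g h) (rnorm_pair_eval g h).

Lemma pair_evalD g h S T : pair_eval g h (S + T) = pair_eval g h S + pair_eval g h T.
Proof. exact: (bounded_opD (pair_dual g h)). Qed.

Lemma pair_eval_le1 g h T : rnorm g <= 1 -> rnorm h <= 1 ->
  rnorm (pair_eval g h T) <= rnorm T.
Proof.
move=> g1 h1; rewrite (le_trans (rnorm_pair_eval _ _ _))// ler_piMl ?rnorm_ge0//.
by rewrite mulr_ile1 ?rnorm_ge0.
Qed.

(* An operator T is compact iff its adjoint is weak*-to-norm continuous on
   bounded sets, which makes (g, h) |-> g (h o T) jointly continuous. *)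
Lemma pair_eval_cvg (I : Type) (F : set_system I) (FF : ProperFilter F)
    (u : I -> dual (dual X)) (v : I -> dual Y) g h T :
  (forall i, rnorm (u i) <= 1) -> (forall i, rnorm (v i) <= 1) -> rnorm h <= 1 ->
  (forall f, (u i f : K^o) @[i --> F] --> (g f : K^o)) ->
  (forall y, (v i y : K^o) @[i --> F] --> (h y : K^o)) ->
  forall e, 0 < e -> \forall i \near F, rnorm (pair_eval (u i) (v i) T - pair_eval g h T) < e.
Proof.
move=> u1 v1 h1 ug vh e e0.
have e20 : 0 < e / 2 by rewrite divr_gt0.
have e60 : 0 < e / 2 / 3 by rewrite divr_gt0.
have cT : compact (closure ((T : bounded_op X Y) @` unit_ball (V := X))).
  by apply/asboolP; exact: (valP T).
(* Compactness of the closed image of the ball makes the pointwise convergence of [v i] uniform on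
   it, by equicontinuity. *)
have /compact_near_coveringP/(_ I F (fun i y => rnorm (v i y - h y) < e / 2) _) := cT.
have near_v : \forall i \near F, rnorm (u i (bounded_op_comp h T) - g (bounded_op_comp h T) : K^o) < e / 2.
  by have /cvg_rnormP := ug (bounded_op_comp h T); exact.
move=> cov; have {cov}cov : \forall i \near F, closure ((T : bounded_op X Y) @` unit_ball (V := X)) `<=` (fun y => rnorm (v i y - h y : K^o) < e / 2).
  apply: cov => y _.
  have vy : \forall i \near F, rnorm (v i y - h y : K^o) < e / 2 / 3.
    by have /cvg_rnormP := vh y; exact.
  have yy : \forall y' \near y, rnorm (y' - y) < e / 2 / 3.
    by have /cvg_rnormP := @cvg_id _ (nbhs y); exact.
  near=> y' i => /=.
  have a1 : rnorm (y' - y) < e / 2 / 3 by near: y'.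
  have a2 : rnorm (v i y - h y : K^o) < e / 2 / 3 by near: i.
  have -> : v i y' - h y' = v i (y' - y) + (v i y - h y) + h (y - y') :> K^o.
    rewrite !bounded_opB; move: (v i y') (v i y) (h y) (h y') => a b c d.
    by rewrite [a - b + (b - c)]addrA subrK addrA subrK.
  have a3 : rnorm (v i (y' - y)) < e / 2 / 3.
    by rewrite (le_lt_trans _ a1)// (le_trans (ler_rnorm_op _ _))// ler_piMl ?rnorm_ge0.
  have a4 : rnorm (h (y - y')) < e / 2 / 3.
    by rewrite (le_lt_trans _ a1)// (le_trans (ler_rnorm_op _ _))// (rnorm_distC y') ler_piMl ?rnorm_ge0.
  have := ler_rnormD (v i (y' - y) + (v i y - h y) : K^o) (h (y - y')).
  have := ler_rnormD (v i (y' - y) : K^o) (v i y - h y).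
  lra.
near=> i.
have b1 : rnorm (u i (bounded_op_comp h T) - g (bounded_op_comp h T) : K^o) < e / 2 by near: i.
have b2 : rnorm (bounded_op_comp (v i - h) T) <= e / 2.
  apply: rnorm_op_le => x x1; apply: ltW.
  apply: (_ : closure ((T : bounded_op X Y) @` unit_ball (V := X)) `<=` (fun y => rnorm (v i y - h y : K^o) < e / 2)); first by near: i.
  by apply: subset_closure; exists x.
(* The first term is small by uniformity and [|u i| <= 1]; in the second, [u i] is evaluated at a
   fixed functional, so pointwise convergence suffices. *)
rewrite (_ : _ - _ = u i (bounded_op_comp (v i - h) T) +
    (u i (bounded_op_comp h T) - g (bounded_op_comp h T))).
  rewrite [e]splitr (le_lt_trans (ler_rnormD _ _))// ler_ltD// (le_trans (ler_rnorm_op _ _))//.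
  by rewrite (le_trans _ b2)// ler_piMl ?rnorm_ge0.
rewrite addrA -bounded_opD /pair_eval; congr (u i _ - _).
by apply/val_inj/funext => x /=; rewrite -[RHS]/((v i (T x) - h (T x)) + h (T x)) subrK.
Unshelve. all: by end_near.
Qed.

End compact_trees.

Section evaluation.
Context (R : realType) (s : scalars).
Local Notation K := (scalar_field R s).
Context (V : normedModType K) (x : V).

Lemma eval_linear : linear (fun f : dual V => f x : K^o).
Proof. by []. Qed.

Lemma eval_bound (f : dual V) : rnorm (f x) <= rnorm x * rnorm f.
Proof. by rewrite mulrC ler_rnorm_op. Qed.

Definition eval_dual : dual (dual V) := bounded_op_of eval_linear eval_bound.

Lemma rnorm_eval_dual : rnorm eval_dual <= rnorm x.
Proof. exact: (rnorm_bounded_op_of _ _ (rnorm_ge0 _)). Qed.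

End evaluation.

(** * Limits of norming pairs along a tree *)

Section tree_limit.
Context (R : realType) (s : scalars).
Local Notation K := (scalar_field R s).
Context (X Y : normedModType K).
Local Notation Z := (compact_op X Y).
Implicit Types (g : dual (dual X)) (h : dual Y) (T : Z) (a : nat -> R).
Local Notation re := (@to_real R s).
Local Notation BX := (unit_ball (V := dual (dual X))).
Local Notation BY := (unit_ball (V := dual Y)).

(* k and l are strict upper bounds for the Szlenk ranks of g and h: hence the 2. *)
Definition ranked n g h a := forall t k l, 0 < t ->
  ~ szlenk_n (t / 2) BX k g -> ~ szlenk_n (t / 2) BY l h ->
  ((\sum_(i < n) (t < a i)%R) + 2 <= k + l)%N.

(** If [f] is already outside the n-th derivative, so are the nearby [u i]; otherwise [f] has a
    neighborhood in which that derivative has diameter at most [e]. *)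
Lemma near_szlenk_derivation (V : normedModType K) (I : Type) (F : set_system I)
    (FF : Filter F) (u : I -> dual V) (f : dual V) e n :
  unit_ball (V := dual V) f -> (forall v, (u i v : K^o) @[i --> F] --> (f v : K^o)) ->
  ~ szlenk_n e (unit_ball (V := dual V)) n.+1 f ->
  \forall i \near F, szlenk_n e (unit_ball (V := dual V)) n (u i) -> rnorm (u i - f) <= e.
Proof.
move=> f1 uf nf; have [fn|fn] := pselect (szlenk_n e (unit_ball (V := dual V)) n f); last first.
  have [U [oU Uf UA]] := not_szlenk_n_open f1 fn.
  by have := weak_star_nbhs FF uf oU Uf; apply: filterS => i /UA.
have [U [oU Uf UA]] := not_szlenk_derivation fn nf.
by have := weak_star_nbhs FF uf oU Uf; apply: filterS => i Ui ui; exact: UA.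
Qed.

Lemma near_not_szlenk_n (V : normedModType K) (I : Type) (F : set_system I)
    (FF : Filter F) (u : I -> dual V) (f : dual V) e n :
  unit_ball (V := dual V) f -> (forall v, (u i v : K^o) @[i --> F] --> (f v : K^o)) ->
  ~ szlenk_n e (unit_ball (V := dual V)) n f -> \forall i \near F, ~ szlenk_n e (unit_ball (V := dual V)) n (u i).
Proof.
move=> f1 uf nf; have [U [oU Uf UA]] := not_szlenk_n_open f1 nf.
by have := weak_star_nbhs FF uf oU Uf; apply: filterS => i /UA.
Qed.

(** A new entry above [t] is paid for by a rank. If neither rank dropped on passing from [(g, h)] to
    [(u z, v z)], both components would move by at most [t / 2]; as [pair_eval g h z] is almost 0,
    the value [b z] could not stay above [t]. *)
Lemma ranked_limit (F : set_system Z) (FF : ProperFilter F) n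
    (u : Z -> dual (dual X)) (v : Z -> dual Y) (a : Z -> nat -> R) (b : Z -> R) g h (l : nat -> R) m :
  (forall i, rnorm (u i) <= 1) -> (forall i, rnorm (v i) <= 1) ->
  rnorm g <= 1 -> rnorm h <= 1 ->
  (forall f, (u i f : K^o) @[i --> F] --> (g f : K^o)) ->
  (forall y, (v i y : K^o) @[i --> F] --> (h y : K^o)) ->
  (forall k, a i k @[i --> F] --> l k) -> b i @[i --> F] --> m ->
  weakly_null F ->
  (\forall z \near F, [/\ rnorm z <= 1, b z = re (pair_eval (u z) (v z) z) & ranked n (u z) (v z) (a z)]) ->
  ranked n.+1 g h (fun k => if k is j.+1 then l j else m).
Proof.
move=> u1 v1 g1 h1 ug vh al bm Fn Fz t p q t0 gp hq.
(* Strict rank bounds are positive, as [g] and [h] lie in the balls. *)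
case: p gp => [/(_ g1)//|p] gp; case: q hq => [/(_ h1)//|q] hq.
have near_a : \forall z \near F, forall i : 'I_n, t < l i -> t < a z i.
  apply: filter_forall => i.
  have [tl|tl] := boolP (t < l i); last by apply: nearW.
  have h' : F [set z | t < a z i] := cvgr_gt (l i) (al i) _ tl.
  by near=> z => _; near: z; exact: h'.
have near_u := near_szlenk_derivation _ g1 ug gp.
have near_v := near_szlenk_derivation _ h1 vh hq.
have near_u' := near_not_szlenk_n _ g1 ug gp.
have near_v' := near_not_szlenk_n _ h1 vh hq.
have -> : (\sum_(i < n.+1) (t < if (i : nat) is j.+1 then l j else m)%R)%N =
    ((t < m)%R + \sum_(i < n) (t < l i)%R)%N by rewrite big_ord_recl.
have suml z : (forall i : 'I_n, t < l i -> t < a z i) ->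
    (\sum_(i < n) (t < l i)%R <= \sum_(i < n) (t < a z i)%R)%N.
  by move=> h'; apply: leq_sum => i _; case: ltP (h' i) => // _ ->.
have [tm|mt] := ltP t m; last first.
  near F => z.
  have [_ _ rk] : [/\ rnorm z <= 1, b z = re (pair_eval (u z) (v z) z) & ranked n (u z) (v z) (a z)] by near: z.
  rewrite add0n (leq_trans _ (rk t p.+1 q.+1 t0 _ _)) ?leq_add2r//.
  - by apply: suml; near: z.
  - by near: z; exact: near_u'.
  - by near: z; exact: near_v'.
(* Half of the excess, so that [m - d = t + d]. *)
pose d := (m - t) / 2; have d0 : 0 < d by rewrite divr_gt0 ?subr_gt0.
have md : m - d < m by rewrite ltrBlDr ltrDl.
near F => z.
have [z1 bz rk] : [/\ rnorm z <= 1, b z = re (pair_eval (u z) (v z) z) & ranked n (u z) (v z) (a z)] by near: z.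
have zd : rnorm (pair_eval g h z) < d by near: z; exact: (Fn (pair_dual g h)).
have bd : m - d < b z by near: z; exact: (cvgr_gt m).
have nu : ~ szlenk_n (t / 2) BX p.+1 (u z) by near: z; exact: near_u'.
have nv : ~ szlenk_n (t / 2) BY q.+1 (v z) by near: z; exact: near_v'.
have sl : (\sum_(i < n) (t < l i)%R <= \sum_(i < n) (t < a z i)%R)%N.
  by apply: suml; near: z.
have [uz|uz] := pselect (szlenk_n (t / 2) BX p (u z)); last first.
  by move: sl (rk _ _ _ t0 uz nv); clear; lia.
have [vz|vz] := pselect (szlenk_n (t / 2) BY q (v z)); last first.
  by move: sl (rk _ _ _ t0 nu vz); clear; lia.
have ugz : rnorm (u z - g) <= t / 2 by move: uz; near: z; exact: near_u.
have vhz : rnorm (v z - h) <= t / 2 by move: vz; near: z; exact: near_v.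
exfalso; suff : b z <= t + d by move: bd; rewrite /d; lra.
have e1 : pair_eval (u z) (v z) z =
    pair_eval (u z) (v z - h) z + (pair_eval (u z - g) h z + pair_eval g h z).
  rewrite /pair_eval -[(u z - g) _]/(u z _ - g _) subrK -bounded_opD; congr (u z _).
  by apply/val_inj/funext => x /=; rewrite -[RHS]/((v z (z x) - h (z x)) + h (z x)) subrK.
rewrite bz e1 to_realD (to_realD (pair_eval (u z - g) h z)).
have q1 : re (pair_eval (u z) (v z - h) z) <= t / 2.
  rewrite (le_trans (ler_to_real _))// (le_trans (rnorm_pair_eval _ _ _))//.
  rewrite -[leRHS]mulr1 ler_pM ?mulr_ge0 ?rnorm_ge0//.
  by rewrite -[leRHS]mul1r ler_pM ?rnorm_ge0.
have q2 : re (pair_eval (u z - g) h z) <= t / 2.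
  rewrite (le_trans (ler_to_real _))// (le_trans (rnorm_pair_eval _ _ _))//.
  rewrite -[leRHS]mulr1 ler_pM ?mulr_ge0 ?rnorm_ge0//.
  by rewrite -[leRHS]mulr1 ler_pM ?rnorm_ge0.
have q3 := le_lt_trans (ler_to_real _) zd.
lra.
Unshelve. all: by end_near.
Qed.

(** From the leaves to the root: the pairs found for the subtrees converge weak* along an
    ultrafilter refining that of the node. The value at [z0 + z] splits; the part at [z0] converges
    to that of the limit pair, and the limit of the part at [z] becomes the new entry of [a]. *)
Lemma large_tree_limit c n (z0 : Z) : large_tree c n z0 ->
  exists g h a, [/\ rnorm g <= 1, rnorm h <= 1, forall i, `|a i| <= 1,
    c <= re (pair_eval g h z0) + \sum_(i < n) a i & ranked n g h a].
Proof.
elim: n z0 => [|n IH] z0.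
  move=> /rnorm_op_gt[x x1 cx]; have [h h1 hx] := norming_functional (z0 x).
  have g1 : rnorm (eval_dual x) <= 1 := le_trans (rnorm_eval_dual _) x1.
  exists (eval_dual x), h, (fun=> 0); split => //.
  - by move=> _; rewrite normr0.
  - rewrite big_ord0 addr0 -[pair_eval _ _ _]/(h (z0 x)) hx; exact: ltW.
  (* At a leaf, membership in the balls already gives [k, l >= 1], which is the [2] in [ranked]. *)
  - by move=> t [|k] [|l] t0 //= nk nl; rewrite big_ord0; lia.
move=> [F0 [F0F F0n F0z]].
have [F [UF F0F']] := ultraFilterLemma F0F.
have Fn : weakly_null F by move=> f e e0; apply: F0F'; exact: F0n.
have Fz := F0F' _ F0z.
have : forall z : Z, exists w : dual (dual X) * dual Y * (nat -> R) * R, [/\ rnorm w.1.1.1 <= 1,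
    rnorm w.1.1.2 <= 1, forall i, `|w.1.2 i| <= 1, `|w.2| <= 1 &
    rnorm z <= 1 -> large_tree c n (z0 + z) -> [/\
      w.2 = re (pair_eval w.1.1.1 w.1.1.2 z),
      c <= re (pair_eval w.1.1.1 w.1.1.2 (z0 + z)) + \sum_(i < n) w.1.2 i &
      ranked n w.1.1.1 w.1.1.2 w.1.2]].
  move=> z; have [[z1 tz]|nz] := pselect (rnorm z <= 1 /\ large_tree c n (z0 + z)).
    have [g [h [a [g1 h1 a1 ca rk]]]] := IH _ tz.
    exists (g, h, a, re (pair_eval g h z)); split => //=.
    by rewrite (le_trans (ler_norm_to_real _))// (le_trans (pair_eval_le1 _ _ _)).
  (* Default values, which keep all four families bounded off the good set. *)
  exists (0, 0, fun=> 0, 0); split; rewrite ?rnorm0 ?ler01 /= ?normr0//.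
  by move=> z1 tz; case: nz.
move=> /choice[w wP].
pose u z := (w z).1.1.1; pose v z := (w z).1.1.2; pose a z := (w z).1.2; pose b z := (w z).2.
have u1 z : rnorm (u z) <= 1 by case: (wP z).
have v1 z : rnorm (v z) <= 1 by case: (wP z).
have [g g1 ug] := alaoglu_ultra UF u1.
have [h h1 vh] := alaoglu_ultra UF v1.
have /choice[l lP] : forall k, exists l : R, `|l| <= 1 /\ (a z k @[z --> F] --> l).
  move=> k; have [l l1 al] : exists2 l : R, `|l| <= 1 & a z k @[z --> F] --> l.
    by apply: (ultra_bounded_real (u := fun z => a z k) UF) => z; case: (wP z) => _ _ h' _ _; exact: h'.
  by exists l.
have [m m1 bm] : exists2 m : R, `|m| <= 1 & b z @[z --> F] --> m.
  by apply: (ultra_bounded_real (u := b) UF) => z; case: (wP z).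
have wz : \forall z \near F, [/\ rnorm z <= 1, b z = re (pair_eval (u z) (v z) z),
    c <= re (pair_eval (u z) (v z) (z0 + z)) + \sum_(i < n) a z i &
    ranked n (u z) (v z) (a z)].
  apply: filterS Fz => z [z1 tz].
  by have [_ _ _ _ /(_ z1 tz)[]] := wP z; split.
exists g, h, (fun k => if k is j.+1 then l j else m); split => //.
- by case=> [//|k]; case: (lP k).
- have cvr : re (pair_eval (u z) (v z) z0) @[z --> F] --> re (pair_eval g h z0).
    apply/cvgrPdist_lt => e e0.
    have := @pair_eval_cvg R s X Y Z F _ u v g h z0 u1 v1 h1 ug vh e e0 => h'.
    near=> z; rewrite distrC -to_realB (le_lt_trans (ler_norm_to_real _))//.
    by near: z; exact: h'.
  have cvs k : (\sum_(i < k) a z i) @[z --> F] --> \sum_(i < k) l i.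
    elim: k => [|k IHk].
      by rewrite big_ord0; under eq_fun do rewrite big_ord0; exact: cvg_cst.
    rewrite big_ord_recr; under eq_fun do rewrite big_ord_recr.
    by apply: cvgD => //=; case: (lP k).
  rewrite big_ord_recl /= addrA.
  apply: (cvgr_to_ge (cvgD (cvgD cvr bm) (cvs n))).
  apply: filterS wz => z [_ bz + _].
  by rewrite pair_evalD to_realD -bz.
- apply: (@ranked_limit F _ n u v a b g h l m u1 v1 g1 h1 ug vh _ bm Fn).
    by move=> k; case: (lP k).
  by apply: filterS wz => z [].
Unshelve. all: by end_near.
Qed.

End tree_limit.

(** * Summation over dyadic levels *)

Section counting.
Context (R : realType).
Implicit Types (t a c r : R).

(** If [a] exceeds [2 ^ L * c], all lower layers are present and add up to [(2 ^ L - 1) * c]. *)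
Lemma dyadic_layers (L : nat) c a : 0 <= c -> a <= 2 ^+ L * c ->
  a <= c + \sum_(j < L) 2 ^+ j * c * (2 ^+ j * c < a)%R%:R.
Proof.
move=> c0; elim: L => [|L IH] aL; first by rewrite big_ord0 addr0 -[leRHS]mul1r -(expr0 2).
rewrite big_ord_recr /=; have [aL'|aL'] := leP a (2 ^+ L * c).
  by rewrite mulr0 addr0 IH.
have -> : \sum_(j < L) 2 ^+ j * c * (2 ^+ j * c < a)%R%:R = (2 ^+ L - 1) * c.
  have -> : 2 ^+ L - 1 = \sum_(j < L) 2 ^+ j :> R.
    by rewrite subrX1 (_ : 2 - 1 = 1 :> R) ?mul1r//; ring.
  rewrite mulr_suml; apply: eq_bigr => j _.
  rewrite (le_lt_trans _ aL') ?mulr1// ler_wpM2r// ler_weXn2l ?ler1n//.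
  exact: ltnW.
by move: aL; rewrite exprS mulr1; lra.
Qed.

(** The layer at height [2 ^ j * c] contributes at most [C * (2 ^ j * c) ^ (1 - r)]; as [r > 1],
    these terms form a convergent geometric series of ratio [q]. *)
Lemma sum_le_powR_count r C : 1 < r -> 0 < C -> exists2 C', 0 < C' &
  forall (n : nat) (a : nat -> R) t, 0 < t -> (forall i, a i <= 1) ->
    (forall u, 0 < u -> (\sum_(i < n) (u < a i)%R)%N%:R <= C * u `^ (- r)) ->
    n%:R * t <= \sum_(i < n) a i -> n%:R <= C' * t `^ (- r).
Proof.
move=> r1 C0; pose q : R := 2 `^ (1 - r).
have q0 : 0 < q by rewrite powR_gt0.
have q1 : q < 1.
  have ln2 : 0 < ln (2 : R) by rewrite ln_gt0// ltr1n.
  by rewrite /q /powR gt_eqF// -[ltRHS]expR0 ltr_expR pmulr_llt0// subr_lt0.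
have q1' : 0 < 1 - q by rewrite subr_gt0.
exists (C / (1 - q) * 2^-1 `^ (- r)); first by rewrite mulr_gt0 ?divr_gt0 ?powR_gt0.
(* The base layer [c = t / 2] accounts for only half of [n * t], so the dyadic layers carry the
   other half. *)
move=> n a t t0 a1 aC nt; pose c := t / 2.
have c0 : 0 < c by rewrite divr_gt0.
have [L Lc] : exists L, 1 <= 2 ^+ L * c.
  exists (Num.trunc c^-1).+1; rewrite -ler_pdivrMr// mul1r.
  have /truncn_itv/andP[_ /ltW h] : 0 <= c^-1 by rewrite invr_ge0 ltW.
  by rewrite (le_trans h)// -natrX ler_nat ltnW// ltn_expl.
have ale i : a i <= c + \sum_(j < L) 2 ^+ j * c * (2 ^+ j * c < a i)%R%:R.
  by apply: dyadic_layers; [exact: ltW|exact: le_trans (a1 i) Lc].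
have term (j : 'I_L) : \sum_(i < n) 2 ^+ j * c * (2 ^+ j * c < a i)%R%:R <=
    C * c `^ (1 - r) * q ^+ j.
  have u0 : 0 < 2 ^+ j * c by rewrite mulr_gt0 ?exprn_gt0.
  rewrite -mulr_sumr -natr_sum.
  apply: (@le_trans _ _ (2 ^+ j * c * (C * (2 ^+ j * c) `^ (- r)))).
    by rewrite ler_pM2l// aC.
  rewrite mulrCA -mulrA ler_pM2l//.
  rewrite -{1}(powRr1 (ltW u0)) -powRD; last by rewrite (gt_eqF u0) implybT.
  rewrite powRM ?exprn_ge0 ?(ltW c0)// mulrC.
  have -> : (2 ^+ j) `^ (1 - r) = q ^+ j.
    by rewrite -powR_mulrn// -powRrM (mulrC j%:R) powRrM powR_mulrn// powR_ge0.
  exact: lexx.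
have sumle : n%:R * t <= n%:R * c + \sum_(j < L) C * c `^ (1 - r) * q ^+ j.
  apply: (le_trans nt); apply: (@le_trans _ _ (\sum_(i < n) (c + \sum_(j < L) 2 ^+ j * c * (2 ^+ j * c < a i)%R%:R))).
    by apply: ler_sum => i _.
  rewrite big_split /= sumr_const card_ord -[_ *+ n]mulr_natl lerD2l exchange_big /=.
  by apply: ler_sum => j _; exact: term.
have geo : \sum_(j < L) q ^+ j <= (1 - q)^-1.
  rewrite -[leRHS]mul1r ler_pdivlMr// mulrC.
  have -> : (1 - q) * \sum_(j < L) q ^+ j = 1 - q ^+ L by rewrite -opprB mulNr -subrX1 opprB.
  by rewrite gerBl exprn_ge0 // ltW.
have tc : t = 2 * c by rewrite /c mulrC divfK.
have : n%:R * c <= C * c `^ (1 - r) * (1 - q)^-1.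
  move: sumle; rewrite -mulr_sumr {1}tc mulrCA mulrDl mul1r lerD2l => /le_trans; apply.
  by rewrite ler_pM2l ?mulr_gt0 ?powR_gt0.
rewrite powRD; last by rewrite (gt_eqF c0) implybT.
rewrite powRr1 ?(ltW c0)// => h.
rewrite -(ler_pM2r c0) (le_trans h)// /c powRM ?(ltW t0) ?invr_ge0//.
by rewrite le_eqVlt; apply/orP; left; apply/eqP; ring.
Qed.

End counting.

Section szlenk_bound.
Context (R : realType) (s : scalars).
Local Notation K := (scalar_field R s).
Context (V : normedModType K).
Local Notation B := (unit_ball (V := dual V)).
Context (C r : R).
Hypothesis bound : forall e n, 0 < e -> szlenk_n e B n !=set0 -> n%:R <= C * e `^ (- r).

Lemma szlenk_bound_ge0 e : 0 < e -> 0 <= C * e `^ (- r).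
Proof. by move=> e0; apply: (bound (n := 0) e0); exists 0; exact: unit_ball0. Qed.

Lemma szlenk_bound_finite : finite_szlenk V.
Proof.
move=> e e0; exists (Num.trunc (C * e `^ (- r))).+1.
apply/eqP; apply/negPn/negP => /set0P/(bound e0); rewrite leNgt => /negP; apply.
by have /truncn_itv/andP[] := szlenk_bound_ge0 e0.
Qed.

Lemma szlenk_bound_power_type_le : 0 <= r -> szlenk_power_type V <= r.
Proof.
move=> r0; have fin := szlenk_bound_finite.
have C0 : 0 <= C.
  by have := szlenk_bound_ge0 ltr01; rewrite powR1 mulr1.
apply: (@szlenk_power_type_le _ _ _ fin (C + 1)); first by rewrite ltr_wpDl.
near=> e; have /andP[e0 e1] : 0 < e < 1 by near: e; exact: near0_01.
have Npos := szlenk_nat_gt0 (fin _ e0).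
(* The derivative before the last is nonempty, so the bound holds for [N e - 1]; the missing 1 is
   absorbed by [e ^ (- r) >= 1], whence the constant [C + 1]. *)
have /(bound e0) : szlenk_n e B (szlenk_nat V e).-1 !=set0.
  apply/set0P/negP => /eqP /szlenk_nat_le.
  by rewrite leqNgt prednK// leqnn.
have -> : (szlenk_nat V e)%:R = (szlenk_nat V e).-1%:R + 1 :> R.
  by rewrite natr1 prednK.
have p1 : 1 <= e `^ (- r).
  rewrite powRN -invr1 lef_pV2 ?posrE ?powR_gt0//.
  have r1 : 1 = 1 `^ r :> R by rewrite powR1.
  by rewrite [leRHS]r1 ge0_ler_powR ?nnegrE ?(ltW e0) ?(ltW e1) ?ler01.
by rewrite mulrDl mul1r => h; rewrite lerD.
Unshelve. all: by end_near.
Qed.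

End szlenk_bound.

(** * Upper bounds from asymptotic smoothness *)

Section asymptotic_smoothness.
Context (R : realType) (s : scalars).
Local Notation K := (scalar_field R s).
Context (V : normedModType K) (q : R).

(* A weak form of asymptotic uniform smoothness of power type q. *)
Definition asymptotically_smooth := forall (x : V) (F : set_system V),
  ProperFilter F -> weakly_null F -> (\forall z \near F, rnorm z <= 1) ->
  \forall z \near F, rnorm (x + z) `^ q <= rnorm x `^ q + 2.

Hypotheses (q1 : 1 < q) (smooth : asymptotically_smooth).

(** A suitable child exists at each node, so some branch raises the q-th power of the norm by at
    most 2 per step. *)
Lemma large_tree_smooth c n (x : V) : 0 <= c -> large_tree c n x ->
  c `^ q <= rnorm x `^ q + 2 * n%:R.
Proof.
move=> c0; have q0 : 0 <= q by rewrite (le_trans ler01)// ltW.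
elim: n x => [|n IH] x /=.
  by move=> cx; rewrite mulr0 addr0 ge0_ler_powR ?nnegrE ?rnorm_ge0// ltW.
move=> [F [FF Fn Fx]].
have F1 : \forall z \near F, rnorm z <= 1 by apply: filterS Fx => z [].
have [z [[_ /IH cz] xz]] := filter_ex (filterI Fx (smooth x FF Fn F1)).
by rewrite (le_trans cz)// -[n.+1%:R]natr1; move: xz; lra.
Qed.

(** Branch sums at least [n * e / 10] with q-th power at most [2 * n] give
    [n ^ (q - 1) <= 2 * 10 ^ q * e ^ (- q)]. *)
Lemma smooth_szlenk_bound : exists C, forall e n, 0 < e ->
  szlenk_n e (unit_ball (V := dual V)) n !=set0 -> n%:R <= C * e `^ (- (q / (q - 1))).
Proof.
have q0 : 0 < q by rewrite (lt_trans ltr01).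
have qm0 : 0 < q - 1 by rewrite subr_gt0.
exists ((2 * 10 `^ q) `^ (q - 1)^-1) => e [|n] e0 [f fn].
  by rewrite mulr_ge0 ?powR_ge0.
have n0 : 0 < n.+1%:R :> R by rewrite ltr0n.
(* The tree starts at 0, where [f] vanishes, so the strict lower bound must be negative; this choice
   gives up half of the gain [n * e / 5]. *)
have t0 : - (n.+1%:R * (e / 10)) < to_real (f 0 : K).
  by rewrite bounded_op0 to_real0 oppr_lt0 mulr_gt0// divr_gt0.
have := large_tree_szlenk e0 fn t0.
have -> : - (n.+1%:R * (e / 10)) + n.+1%:R * (e / 5) = n.+1%:R * (e / 10) by lra.
have c0 : 0 <= n.+1%:R * (e / 10) by rewrite mulr_ge0 ?divr_ge0 ?ltW.
move=> /(large_tree_smooth c0); rewrite rnorm0 powR0 ?gt_eqF// add0r => h.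
have h2 : n.+1%:R `^ (q - 1) <= 2 * 10 `^ q * e `^ (- q).
  have eq0 : 0 < (e / 10) `^ q by rewrite powR_gt0// divr_gt0.
  have e10 : (e / 10) `^ q = e `^ q / 10 `^ q.
    rewrite powRM ?(ltW e0) ?invr_ge0//; congr (_ * _).
    by rewrite -[10^-1]powR_inv1 ?ler0n// -powRrM mulN1r powRN.
  rewrite -(ler_pM2r n0) -{2}(powRr1 (ltW n0)) -powRD; last by rewrite (gt_eqF n0) implybT.
  rewrite subrK -(ler_pM2r eq0) -powRM ?(ltW n0) ?divr_ge0 ?(ltW e0)//.
  rewrite (le_trans h)// e10 powRN le_eqVlt; apply/orP; left; apply/eqP; field.
  by rewrite !powR_eq0 !gt_eqF.
have -> : n.+1%:R = (n.+1%:R `^ (q - 1)) `^ (q - 1)^-1 :> R.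
  by rewrite -powRrM mulfV ?gt_eqF// powRr1// ltW.
have -> : - (q / (q - 1)) = - q * (q - 1)^-1 by rewrite mulNr.
rewrite (powRrM e) -powRM ?mulr_ge0 ?powR_ge0//.
by rewrite ge0_ler_powR ?nnegrE ?invr_ge0 ?(ltW qm0) ?mulr_ge0 ?powR_ge0.
Qed.

Lemma smooth_finite_szlenk : finite_szlenk V.
Proof. by have [C hC] := smooth_szlenk_bound; exact: szlenk_bound_finite hC. Qed.

Lemma smooth_szlenk_power_type : szlenk_power_type V <= q / (q - 1).
Proof.
have [C hC] := smooth_szlenk_bound; apply: szlenk_bound_power_type_le hC _.
by rewrite divr_ge0 ?subr_ge0 ?(ltW q1)// (le_trans ler01)// ltW.
Qed.

End asymptotic_smoothness.

(** * Lower bounds from weak*-null sequences *)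

Section weakly_null_basis.
Context (R : realType) (s : scalars).
Local Notation K := (scalar_field R s).
Context (V : normedModType K) (r : R) (g : nat -> dual V).
Local Notation B := (unit_ball (V := dual V)).
Hypotheses (r0 : 0 < r) (fin : finite_szlenk V).
Hypothesis g_null : forall v, (g m v : K^o) @[m --> \oo] --> (0 : K^o).
Hypothesis g_norm : forall m, 1 <= rnorm (g m).
Hypothesis g_sum : forall F : seq nat, uniq F ->
  rnorm (\sum_(i <- F) g i) <= (size F)%:R `^ r^-1.

(** Adding a further term with large index is a small weak* perturbation but moves the sum by more
    than [e]; each of the [n] places left free therefore pays for one derivation. The factor is the
    one that keeps sums of [n] terms in the ball. *)
Lemma szlenk_n_basis e n k F : (0 < n)%N -> e < n%:R `^ (- r^-1) ->
  uniq F -> (size F + k <= n)%N ->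
  szlenk_n e B k (of_real s (n%:R `^ (- r^-1)) *: \sum_(i <- F) g i).
Proof.
move=> n0 en; set t := n%:R `^ (- r^-1).
have n0' : 0 < n%:R :> R by rewrite ltr0n.
have t0 : 0 < t by rewrite powR_gt0.
have rV0 : 0 <= r^-1 by rewrite invr_ge0 ltW.
elim: k F => [|k IH] F uF Fn.
  rewrite /szlenk_n/= /unit_ball/= rnormZ_real ?(ltW t0)//.
  rewrite (@le_trans _ _ (t * n%:R `^ r^-1))//; last first.
    by rewrite /t powRN mulVf// gt_eqF ?powR_gt0.
  rewrite ler_pM2l// (le_trans (g_sum uF))// ge0_ler_powR ?nnegrE ?ler0n//.
  by rewrite ler_nat -(addn0 (size F)).
apply/szlenk_derivationP; split.
  by apply: IH => //; rewrite (leq_trans _ Fn)// addnS leqnSn.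
move=> U oU Uf; set f := _ *: _ in Uf *.
have Ug : \forall m \near \oo, U (f + of_real s t *: g m).
  apply: (@weak_star_nbhs R s V nat \oo _ (fun m => f + of_real s t *: g m) f U _ oU Uf) => v.
  have h := g_null v.
  have := cvgD (cvg_cst (f v : K^o) (F := \oo)) (cvgZl_tmp (k := of_real s t) h).
  by rewrite scaler0 addr0; apply.
have mF : \forall m \near \oo, m \notin F.
  near=> m; apply/negP => mF.
  have : (m <= \max_(i <- F) i)%N by exact: leq_bigmax_seq.
  rewrite leqNgt => /negP; apply; near: m; exact: nbhs_infty_gt.
have [m [Um mF']] := filter_ex (filterI Ug mF).
exists (f + of_real s t *: g m), f; split => //.
- have := IH (m :: F); rewrite big_cons scalerDr addrC /= mF' uF; apply => //.
  by rewrite addSnnS.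
- by apply: IH => //; rewrite (leq_trans _ Fn)// addnS leqnSn.
- rewrite addrC addKr rnormZ_real ?(ltW t0)// (lt_le_trans en)//.
  by rewrite ler_peMr ?(ltW t0).
Unshelve. all: by end_near.
Qed.

Lemma basis_szlenk_power_type : r <= szlenk_power_type V.
Proof.
have half0 : (0 : R) < 2^-1 by rewrite invr_gt0.
apply: (@szlenk_power_type_ge _ _ _ fin 2^-1) => //; near=> e.
have e0 : 0 < e by near: e; exact: nbhs_right_gt.
have er0 : 0 < e `^ (- r) by rewrite powR_gt0.
have /truncn_itv/andP[] : 0 <= 2^-1 * e `^ (- r) by rewrite mulr_ge0 ?ltW.
(* The factor 1/2 makes [n < e ^ (- r)] strict, which gives [e < n ^ (- 1 / r)]. *)
set n := Num.trunc _ => n1 n2; rewrite (le_trans (ltW n2))// ler_nat.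
have [->|npos] := posnP n; first by rewrite szlenk_nat_gt0//; exact: fin.
rewrite ltnNge; apply/negP => Nn.
have n0' : 0 < n%:R :> R by rewrite ltr0n.
have en : e < n%:R `^ (- r^-1).
  have -> : e = (e `^ (- r)) `^ (- r^-1).
    by rewrite -powRrM mulrNN mulfV ?gt_eqF// powRr1// ltW.
  rewrite !(powRN _ r^-1) ltf_pV2 ?posrE ?powR_gt0//.
  apply: gt0_ltr_powR; rewrite ?invr_gt0 ?nnegrE ?ler0n ?(ltW er0)//.
  by rewrite (le_lt_trans n1)// gtr_pMl// invf_lt1// ltr1n.
have := @szlenk_n_basis e n n [::] npos en isT (leqnn n).
by move=> /(szlenk_n_decr Nn); rewrite szlenk_nat_eq0//; exact: fin.
Unshelve. all: by end_near.
Qed.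

End weakly_null_basis.

(** * The upper bound for spaces of compact operators *)

Section upper_bound.
Context (R : realType) (s : scalars).
Local Notation K := (scalar_field R s).
Context (X Y : normedModType K).
Local Notation Z := (compact_op X Y).
Hypotheses (finX : finite_szlenk (dual X)) (finY : finite_szlenk Y).
Local Notation BZ := (unit_ball (V := dual Z)).

Lemma szlenk_n_compact_op e n (f : dual Z) : 0 < e -> (0 < n)%N ->
  szlenk_n e BZ n f ->
  exists (g : dual (dual X)) (h : dual Y) (a : nat -> R), [/\ rnorm g <= 1, rnorm h <= 1,
    forall i, a i <= 1, n%:R * (e / 10) <= \sum_(i < n) a i & ranked n g h a].
Proof.
move=> e0 n0 fn.
have t0 : - (n%:R * (e / 10)) < to_real (f 0 : K).
  by rewrite bounded_op0 to_real0 oppr_lt0 mulr_gt0 ?ltr0n// divr_gt0.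
have := large_tree_szlenk e0 fn t0.
move=> /large_tree_limit[g [h [a [g1 h1 a1 ca rk]]]].
exists g, h, a; split => //.
  by move=> i; rewrite (le_trans (ler_norm _)).
have ev0 : pair_eval g h (0 : Z) = 0 by exact: (bounded_op0 (pair_dual g h)).
by move: ca; rewrite ev0 to_real0 add0r; lra.
Qed.

(** The indices of order [u / 2] are rank bounds for every [g] and [h], so the number of entries
    above [u] is [O(u ^ (- r))]; the dyadic summation is applied with [t = e / 10]. *)
Lemma szlenk_compact_op_le_powR r : 1 < r ->
  szlenk_power_type (dual X) < r -> szlenk_power_type Y < r ->
  exists C : R, forall e n, 0 < e -> szlenk_n e BZ n !=set0 ->
    n%:R <= C * e `^ (- r).
Proof.
move=> r1 /(szlenk_nat_le_powR finX)[C1 C10 NX] /(szlenk_nat_le_powR finY)[C2 C20 NY].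
have C120 : 0 < (C1 + C2) * 2^-1 `^ (- r) by rewrite mulr_gt0 ?addr_gt0 ?powR_gt0.
have [C C0 HC] := sum_le_powR_count r1 C120.
exists (C * 10^-1 `^ (- r)) => e [|n] e0 [f fn]; first by rewrite !mulr_ge0 ?powR_ge0// ltW.
have [g [h [a [g1 h1 a1 ca rk]]]] := szlenk_n_compact_op e0 (ltn0Sn n) fn.
rewrite -mulrA -powRM ?(ltW e0) ?invr_ge0// mulrC mulrC (mulrC 10^-1).
apply: (HC _ a) => //; first by rewrite divr_gt0.
(* No entry exceeds 1, and the power bounds on the indices hold for orders up to 1 only. *)
move=> u u0; have [u1|u1] := leP 1 u.
  rewrite big1 => [|i _]; first by rewrite !mulr_ge0 ?addr_ge0 ?powR_ge0 ?ltW.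
  by rewrite ltNge (le_trans (a1 i) u1).
have u20 : 0 < u / 2 by rewrite divr_gt0.
have u2 : 0 < u / 2 <= 1 by rewrite u20/= ler_pdivrMr//; lra.
have := rk u (szlenk_nat (dual X) (u / 2)) (szlenk_nat Y (u / 2)) u0.
rewrite !szlenk_nat_eq0 ?finX ?finY//; [|exact: finY|exact: finX].
move=> /(_ (fun x => x) (fun x => x)) h2.
have {h2} : (\sum_(i < n.+1) (u < a i)%R <= szlenk_nat (dual X) (u / 2) + szlenk_nat Y (u / 2))%N.
  by apply: leq_trans h2; rewrite leq_addr.
rewrite -(ler_nat R) natrD => /le_trans; apply.
rewrite -mulrA -powRM ?(ltW u0) ?invr_ge0// (mulrC 2^-1) mulrDl.
by rewrite lerD ?NX ?NY.
Qed.

Lemma finite_szlenk_compact_op : finite_szlenk Z.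
Proof.
have [r [r1 rX rY]] : exists r, [/\ 1 < r, szlenk_power_type (dual X) < r & szlenk_power_type Y < r].
  move: (szlenk_power_type_ge0 finX) (szlenk_power_type_ge0 finY).
  move: (szlenk_power_type (dual X)) (szlenk_power_type Y) => p q p0 q0.
  by exists (1 + p + q + 1); split; lra.
have [C HC] := szlenk_compact_op_le_powR r1 rX rY.
exact: szlenk_bound_finite HC.
Qed.

(** With the maximum at least 1, every larger exponent exceeds 1, as the dyadic summation
    requires. *)
Lemma szlenk_power_type_compact_op_le :
  1 <= Num.max (szlenk_power_type (dual X)) (szlenk_power_type Y) ->
  szlenk_power_type Z <= Num.max (szlenk_power_type (dual X)) (szlenk_power_type Y).
Proof.
have max_ge (p q : R) : p <= Num.max p q /\ q <= Num.max p q.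
  by rewrite !le_max !lexx orbT.
have [] := max_ge (szlenk_power_type (dual X)) (szlenk_power_type Y).
move: (Num.max _ _) => m mX mY m1; apply/ler_addgt0Pr => d d0.
have rX : szlenk_power_type (dual X) < m + d by rewrite (le_lt_trans mX)// ltrDl.
have rY : szlenk_power_type Y < m + d by rewrite (le_lt_trans mY)// ltrDl.
have [|C HC] := @szlenk_compact_op_le_powR (m + d) _ rX rY.
  by rewrite (le_lt_trans m1)// ltrDl.
apply: szlenk_bound_power_type_le HC _.
by rewrite addr_ge0 ?(ltW d0)// (le_trans _ m1).
Qed.

(** Rank bounds 1 and 1 leave no room for a positive entry, yet a point of the first derivative
    yields an entry of at least [e / 10]. *)
Lemma szlenk_n1_compact_op :
  (forall e, 0 < e -> szlenk_n e (unit_ball (V := dual (dual X))) 1 = set0) ->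
  (forall e, 0 < e -> szlenk_n e (unit_ball (V := dual Y)) 1 = set0) ->
  forall e, 0 < e -> szlenk_n e BZ 1 = set0.
Proof.
move=> X1 Y1 e e0; rewrite -subset0 => f f1.
have [g [h [a [_ _ _ + rk]]]] := szlenk_n_compact_op e0 (ltn0Sn 0) f1.
rewrite big_ord1 mul1r => ae.
have a0 : 0 < a 0%N by rewrite (lt_le_trans _ ae)// divr_gt0.
have a20 : 0 < a 0%N / 2 by rewrite divr_gt0.
have := rk (a 0%N / 2) 1%N 1%N a20.
rewrite X1 ?Y1 ?divr_gt0// big_ord1 ltr_pdivrMr// ltr_pMr// ltr1n/=.
by move=> /(_ (fun x => x) (fun x => x)).
Qed.

End upper_bound.

(** * Rank-one operators and the lower bound *)

Section rank_one.
Context (R : realType) (s : scalars).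
Local Notation K := (scalar_field R s).
Context (X Y : normedModType K).

Lemma compact_scalar_ball (M : R) : compact [set c : K^o | rnorm c <= M].
Proof.
rewrite compact_ultra => F UF FM.
have M0 : 0 <= M by have [c /=] := filter_ex FM; apply: le_trans; exact: rnorm_ge0.
(* Cut off outside the ball, since [ultra_bounded_scalar] asks for a bound at every index. *)
pose u (c : K^o) := if rnorm c <= M then c else 0.
have uM c : rnorm (u c) <= M by rewrite /u; case: ifP => //; rewrite rnorm0.
have [l /cvg_rnormP ul] := ultra_bounded_scalar UF uM.
exists l; split.
  rewrite /=; apply/ler_addgt0Pr => e e0; have [c ce] := filter_ex (ul e e0).
  rewrite -(subrK (u c) l) addrC (le_trans (ler_rnormD _ _))// lerD//.
  by rewrite rnorm_distC ltW.
apply: (proj2 (cvg_rnormP _ id l)) => e e0.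
near=> c; have cM : rnorm c <= M by near: c.
have : rnorm (u c - l) < e by near: c; exact: ul.
by rewrite /u cM.
Unshelve. all: by end_near.
Qed.

Variables (f : dual X) (y : Y).

Lemma rank_one_linear : linear (fun x : X => f x *: y).
Proof. by move=> a u v; rewrite bounded_op_linear scalerDl -scalerA. Qed.

Lemma rank_one_bound x : rnorm (f x *: y) <= (rnorm f * rnorm y) * rnorm x.
Proof. by rewrite rnormZ mulrAC ler_wpM2r ?rnorm_ge0// ler_rnorm_op. Qed.

Definition rank_one_bounded : bounded_op X Y := bounded_op_of rank_one_linear rank_one_bound.

Lemma rank_one_compact : rank_one_bounded \in @compact_op_pred R s X Y.
Proof.
apply/asboolP; pose A := (fun c : K^o => c *: y) @` [set c : K^o | rnorm c <= rnorm f].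
have cA : compact A.
  apply: continuous_compact; last exact: compact_scalar_ball.
  apply: continuous_subspaceT.
  have ly : linear (fun c : K^o => c *: y) by move=> a u v; rewrite scalerDl -scalerA.
  by apply: (bounded_linear_continuous ly (M := rnorm y)) => c; rewrite rnormZ mulrC.
apply: (subclosed_compact _ cA); first exact: closed_closure.
rewrite [X in _ `<=` X](closure_id A).1; last exact: (compact_closed (@norm_hausdorff _ Y) cA).
apply: closureS => _ [x x1 <-]; exists (f x) => //=.
by rewrite (le_trans (ler_rnorm_op _ _))// ler_piMr ?rnorm_ge0.
Qed.

Definition rank_one : compact_op X Y := CompactOp rank_one_compact.

Lemma rnorm_rank_one : rnorm rank_one <= rnorm f * rnorm y.
Proof. by apply: rnorm_bounded_op_of; rewrite mulr_ge0 ?rnorm_ge0. Qed.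

End rank_one.

Section lower_bound.
Context (R : realType) (s : scalars).
Local Notation K := (scalar_field R s).
Context (X Y : normedModType K).
Local Notation Z := (compact_op X Y).
Hypotheses (finX : finite_szlenk (dual X)) (finY : finite_szlenk Y).
Let finZ := finite_szlenk_compact_op finX finY.

Lemma nonzero_functional (V : normedModType K) (v : V) : v != 0 ->
  exists f : dual V, f v != 0.
Proof.
move=> v0; have [f _ fv] := norming_functional v; exists f.
apply: contra_neq v0 => f0; apply: rnorm0_eq0; by rewrite -fv f0 to_real0.
Qed.

(** For [f x0 != 0], the embedding [y |-> f (x) y] has the left inverse [T |-> T x0 / f x0]. *)
Lemma szlenk_power_type_le_compact_op_codomain : (exists x : X, x != 0) ->
  szlenk_power_type Y <= szlenk_power_type Z.
Proof.
move=> [x0 /nonzero_functional[f fx0]].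
have lJ : linear (rank_one f : Y -> Z).
  move=> a y z; apply/val_inj/val_inj/funext => x /=.
  by rewrite -[RHS]/(a *: (f x *: y) + f x *: z) scalerDr !scalerA mulrC.
have lP : linear (fun T : Z => (f x0)^-1 *: T x0).
  move=> a S T; rewrite -[(_ : Z) x0]/(a *: S x0 + T x0).
  by rewrite scalerDr !scalerA mulrC.
have bP (T : Z) : rnorm ((f x0)^-1 *: T x0) <= rnorm ((f x0)^-1 : K^o) * rnorm x0 * rnorm T.
  by rewrite rnormZ -mulrA ler_wpM2l ?rnorm_ge0// mulrC ler_rnorm_op.
apply: (@szlenk_power_type_complemented _ _ _ _ (bounded_op_of lP bP)
  (bounded_op_of lJ (rnorm_rank_one f)) _ finY finZ) => y /=.
by rewrite scalerA mulVf// scale1r.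
Qed.

(** For [h y0 != 0], the embedding [f |-> f (x) y0] has the left inverse [T |-> (h o T) / h y0]. *)
Lemma szlenk_power_type_le_compact_op_domain : (exists y : Y, y != 0) ->
  szlenk_power_type (dual X) <= szlenk_power_type Z.
Proof.
move=> [y0 /nonzero_functional[h hy0]].
have lJ : linear (fun f : dual X => rank_one f y0 : Z).
  move=> a f g; apply/val_inj/val_inj/funext => x /=.
  by rewrite -[RHS]/(a *: (f x *: y0) + g x *: y0) scalerA -scalerDl.
have bJ (f : dual X) : rnorm (rank_one f y0) <= rnorm y0 * rnorm f.
  by rewrite mulrC rnorm_rank_one.
have lP : linear (fun T : Z => (h y0)^-1 *: (bounded_op_comp h T : dual X)).
  by move=> a S T; rewrite adjoint_linear scalerDr !scalerA mulrC.
have bP (T : Z) : rnorm ((h y0)^-1 *: (bounded_op_comp h T : dual X)) <=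
    rnorm ((h y0)^-1 : K^o) * rnorm h * rnorm T.
  by rewrite rnormZ -mulrA ler_wpM2l ?rnorm_ge0// rnorm_bounded_op_comp.
apply: (@szlenk_power_type_complemented _ _ _ _ (bounded_op_of lP bP)
  (bounded_op_of lJ bJ) _ finX finZ) => f /=.
apply/val_inj/funext => x /=.
rewrite -[LHS]/((h y0)^-1 * h (f x *: y0)) bounded_opZ.
by rewrite -[f x *: _]/(f x * h y0) mulrCA mulVf ?mulr1.
Qed.

End lower_bound.

Theorem szlenk_power_type_compact_op (R : realType) (s : scalars)
    (X Y : normedModType (scalar_field R s)) :
  (exists x : X, x != 0) -> (exists y : Y, y != 0) ->
  szlenk_le_omega (dual X) -> szlenk_le_omega Y ->
  szlenk_le_omega (compact_op X Y) /\
  szlenk_power_type (compact_op X Y) =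
    Num.max (szlenk_power_type (dual X)) (szlenk_power_type Y).
Proof.
move=> X0 Y0 /szlenk_le_omegaP finX /szlenk_le_omegaP finY.
have finZ := finite_szlenk_compact_op finX finY.
split; first exact/szlenk_le_omegaP.
have lX := szlenk_power_type_le_compact_op_domain finX finY Y0.
have lY := szlenk_power_type_le_compact_op_codomain finX finY X0.
suff : szlenk_power_type (compact_op X Y) <=
    Num.max (szlenk_power_type (dual X)) (szlenk_power_type Y).
  move: lX lY; move: (szlenk_power_type _) (szlenk_power_type _) (szlenk_power_type _) => z x y xz yz zm.
  by apply/eqP; rewrite eq_le zm ge_max xz yz.
have max_ge (a p q : R) : a <= p \/ a <= q -> a <= Num.max p q.
  by rewrite le_max => -[->//|->]; rewrite orbT.
(* If neither power type reaches 1, the first derivatives are empty for both spaces, hence for the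
   operator space, whose power type is then 0. *)
have [pX|X1] := szlenk_power_type_ge1 finX.
  by apply: szlenk_power_type_compact_op_le => //; apply: max_ge; left.
have [pY|Y1] := szlenk_power_type_ge1 finY.
  by apply: szlenk_power_type_compact_op_le => //; apply: max_ge; right.
rewrite (szlenk_power_type_eq0 finZ); last exact: szlenk_n1_compact_op.
by apply: max_ge; left; exact: szlenk_power_type_ge0.
Qed.

(** * Sequence spaces *)

Section ell.
Context (R : realType) (s : scalars) (p : R) (p1 : 1 <= p).
Local Notation K := (scalar_field R s).
Local Notation E := (ell s p1).
Implicit Types x y z : E.

Let p0 : 0 < p. Proof. exact: lt_le_trans p1. Qed.

Lemma ell_rnormE x : (rnorm x)%:E = ell_norm p x.
Proof.
rewrite /rnorm [X in X%:E](of_realK s (fine (ell_norm p x))) fineK//.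
by rewrite ge0_fin_numE ?ell_norm_ge0//; exact: (valP x).
Qed.

Lemma ell_rnorm_cvg x :
  (\sum_(0 <= k < n) rnorm (x k) `^ p) @[n --> \oo] --> rnorm x `^ p.
Proof.
have h : (\sum_(n <oo) (rnorm (x n) `^ p)%:E)%E = (rnorm x `^ p)%:E.
  rewrite -poweR_EFin ell_rnormE (ell_normE p1) -poweRrM mulVf ?gt_eqF// poweRe1//.
  by apply: nneseries_ge0 => n _ _; rewrite lee_fin powR_ge0.
have : (\sum_(0 <= k < n) (rnorm (x k) `^ p)%:E)%E @[n --> \oo] --> (rnorm x `^ p)%:E.
  rewrite -h; apply: is_cvg_nneseries => n _ _.
  by rewrite lee_fin powR_ge0.
move=> /fine_cvg; apply: cvg_trans; apply: near_eq_cvg; apply: nearW => n /=.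
by rewrite sumEFin.
Qed.

Lemma ell_partial_le x n : \sum_(0 <= k < n) rnorm (x k) `^ p <= rnorm x `^ p.
Proof.
apply: (cvgr_to_ge (@ell_rnorm_cvg x)); near=> m.
have nm : (n <= m)%N by near: m; exact: nbhs_infty_ge.
rewrite (big_cat_nat (leq0n n) nm)//= lerDl sumr_ge0// => i _; exact: powR_ge0.
Unshelve. all: by end_near.
Qed.

Lemma le_of_powR_le (a b : R) : 0 <= a -> 0 <= b -> a `^ p <= b `^ p -> a <= b.
Proof.
move=> a0 b0; rewrite !leNgt; apply: contra => ba.
by apply: gt0_ltr_powR => //; rewrite nnegrE.
Qed.

Lemma ell_coord_le x k : rnorm (x k) <= rnorm x.
Proof.
apply: le_of_powR_le; rewrite ?rnorm_ge0// (le_trans _ (ell_partial_le x k.+1))//.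
by rewrite big_nat_recr//= lerDr sumr_ge0// => i _; exact: powR_ge0.
Qed.

Lemma ell_disjoint x y : (forall k, x k = 0 \/ y k = 0) ->
  rnorm (x + y) `^ p = rnorm x `^ p + rnorm y `^ p.
Proof.
move=> xy; apply: (cvg_unique (@norm_hausdorff _ R^o) (@ell_rnorm_cvg (x + y))).
have -> : (fun n => \sum_(0 <= k < n) rnorm ((x + y) k) `^ p) =
    (fun n => \sum_(0 <= k < n) rnorm (x k) `^ p) +
    (fun n => \sum_(0 <= k < n) rnorm (y k) `^ p); last first.
  exact: (cvgD (@ell_rnorm_cvg x) (@ell_rnorm_cvg y)).
apply/funext => n; rewrite -[RHS]/(_ + _) -big_split; apply: eq_bigr => k _ /=.
change (rnorm (x k + y k) `^ p = rnorm (x k) `^ p + rnorm (y k) `^ p).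
have z0 : (0 : R) `^ p = 0 by rewrite powR0// gt_eqF.
by case: (xy k) => ->; rewrite ?add0r ?addr0 rnorm0 z0 ?add0r ?addr0.
Qed.

Lemma ell_unit_subproof (k : nat) : (fun n => (n == k)%:R : K^o) \in @ell_pred R s p.
Proof.
rewrite inE (ell_normE p1); apply: poweR_lty.
rewrite (nneseriesD1 (n := k))//; last by move=> n _; rewrite lee_fin powR_ge0.
rewrite eseries0; first by rewrite adde0 ltry.
by move=> n _ nk; rewrite (negbTE nk) rnorm0 powR0// gt_eqF.
Qed.

Definition ell_unit (k : nat) : E := @Ell R s p p1 _ (ell_unit_subproof k).

Lemma ell_unitE k n : ell_unit k n = (n == k)%:R. Proof. by []. Qed.

Lemma rnorm1 : rnorm (1 : K^o) = 1.
Proof. by rewrite -[X in rnorm X](of_real1 R s) rnorm_of_real. Qed.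

Lemma rnorm_ell_unit k : rnorm (ell_unit k) = 1.
Proof.
have : rnorm (ell_unit k) `^ p = 1 `^ p.
  apply: (cvg_unique (@norm_hausdorff _ R^o) (@ell_rnorm_cvg (ell_unit k))).
  apply: (@cvg_trans _ (1 `^ p @[n --> \oo])); last exact: cvg_cst.
  apply: near_eq_cvg; near=> n; have kn : (k < n)%N by near: n; exact: nbhs_infty_gt.
  rewrite powR1 (bigD1_seq k) ?mem_index_iota ?iota_uniq//= eqxx rnorm1 powR1.
  by rewrite big1 ?addr0// => i /negbTE ->; rewrite rnorm0 powR0// gt_eqF.
by move=> /powR_injective; apply => //; rewrite nnegrE ?rnorm_ge0.
Unshelve. all: by end_near.
Qed.

Lemma sum_ellE (I : Type) (r : seq I) (f : I -> E) k :
  (\sum_(i <- r) f i) k = \sum_(i <- r) f i k.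
Proof. by elim/big_ind2 : _ => // ? ? ? ? <- <-. Qed.

Definition ell_trunc n x : E := \sum_(0 <= k < n) (x k : K) *: ell_unit k.

Lemma ell_truncE n x k : ell_trunc n x k = if (k < n)%N then x k else 0.
Proof.
rewrite sum_ellE (eq_bigr (fun i => (x i : K) * (k == i)%:R)); last by [].
case: ifPn => kn.
  rewrite (bigD1_seq k) ?mem_index_iota ?iota_uniq//= eqxx mulr1 big1 ?addr0// => i ik.
  by rewrite eq_sym (negbTE ik) mulr0.
rewrite big_seq big1// => i; rewrite mem_index_iota => /andP[_ ni].
by rewrite gtn_eqF ?mulr0// (leq_trans ni)// leqNgt.
Qed.

Lemma ell_trunc_disjoint n x y k : ell_trunc n x k = 0 \/ (y - ell_trunc n y) k = 0.
Proof.
rewrite -[(y - _) k]/(y k - ell_trunc n y k) !ell_truncE.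
by case: ifP => _; [right; rewrite subrr|left].
Qed.

Lemma rnorm_ell_trunc n x : rnorm (ell_trunc n x) `^ p + rnorm (x - ell_trunc n x) `^ p = rnorm x `^ p.
Proof.
rewrite -ell_disjoint; first by rewrite addrC subrK.
exact: ell_trunc_disjoint.
Qed.

Lemma rnorm_ell_trunc_le n x : rnorm (ell_trunc n x) <= rnorm x.
Proof.
by apply: le_of_powR_le; rewrite ?rnorm_ge0// -(rnorm_ell_trunc n x) lerDl powR_ge0.
Qed.

Lemma rnorm_ell_tail_le n x : rnorm (x - ell_trunc n x) <= rnorm x.
Proof.
by apply: le_of_powR_le; rewrite ?rnorm_ge0// -(rnorm_ell_trunc n x) lerDr powR_ge0.
Qed.

Lemma rnorm_ell_truncE n x : rnorm (ell_trunc n x) `^ p = \sum_(0 <= k < n) rnorm (x k) `^ p.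
Proof.
apply: (cvg_unique (@norm_hausdorff _ R^o) (@ell_rnorm_cvg (ell_trunc n x))).
apply: (@cvg_trans _ ((\sum_(0 <= k < n) rnorm (x k) `^ p) @[m --> \oo])); last exact: cvg_cst.
apply: near_eq_cvg; near=> m; have nm : (n <= m)%N by near: m; exact: nbhs_infty_ge.
have tail0 : \sum_(n <= k < m) rnorm (ell_trunc n x k) `^ p = 0.
  rewrite big_nat big1// => k /andP[nk _].
  by rewrite ell_truncE ltnNge nk rnorm0 powR0// gt_eqF.
rewrite [RHS](big_cat_nat (leq0n n) nm)//= tail0 addr0 [LHS]big_nat [RHS]big_nat.
by apply: eq_bigr => k /andP[_ kn]; rewrite ell_truncE kn.
Unshelve. all: by end_near.
Qed.

Lemma ell_tail_small x e : 0 < e -> exists n, rnorm (x - ell_trunc n x) < e.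
Proof.
move=> e0; have ep0 : 0 < e `^ p by rewrite powR_gt0.
have /cvgrPdistC_lt/(_ _ ep0)/filter_ex[n hn] := @ell_rnorm_cvg x.
exists n; rewrite ltNge; apply/negP => en.
have : e `^ p <= rnorm (x - ell_trunc n x) `^ p.
  by rewrite ge0_ler_powR ?nnegrE ?rnorm_ge0 ?(ltW e0) ?(ltW p0).
have := rnorm_ell_trunc n x; rewrite rnorm_ell_truncE.
move: hn; rewrite ltr_norml => /andP[+ _]; lra.
Qed.

Lemma ell_sum_unit (F : seq nat) : uniq F ->
  rnorm (\sum_(i <- F) ell_unit i) `^ p = (size F)%:R.
Proof.
elim: F => [|k F IH] /=; first by rewrite big_nil rnorm0 powR0// gt_eqF.
move=> /andP[kF uF]; rewrite big_cons ell_disjoint.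
  by rewrite IH// rnorm_ell_unit powR1 nat1r.
move=> n; rewrite ell_unitE sum_ellE; have [->|nk] := eqVneq n k; last by left.
right; rewrite big_seq big1// => i iF; rewrite ell_unitE.
by case: eqVneq kF => // ->; rewrite iF.
Qed.

Lemma rnorm_ell_sum_unit (F : seq nat) : uniq F ->
  rnorm (\sum_(i <- F) ell_unit i) = (size F)%:R `^ p^-1.
Proof.
by move=> /ell_sum_unit <-; rewrite -powRrM mulfV ?gt_eqF// powRr1// rnorm_ge0.
Qed.

Lemma ell_coord_linear k : linear (fun x : E => (x k : K^o)).
Proof. by []. Qed.

Lemma ell_coord_bound k x : rnorm (x k) <= 1 * rnorm x.
Proof. by rewrite mul1r ell_coord_le. Qed.

Definition ell_coord k : dual E := bounded_op_of (ell_coord_linear k) (ell_coord_bound k).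

Lemma ell_coordE k x : ell_coord k x = x k. Proof. by []. Qed.

End ell.

Lemma powR_right_continuous (R : realType) (a q : R) : 0 <= a -> 0 < q ->
  exists2 d, 0 < d & forall b, 0 <= b -> b <= a + d -> b `^ q <= a `^ q + 1.
Proof.
move=> a0 q0; have h0 : 0 <= a `^ q + 1 by rewrite addr_ge0 ?powR_ge0.
(* Chosen so that [(a + d) ^ q = a ^ q + 1]. *)
exists ((a `^ q + 1) `^ q^-1 - a).
  rewrite subr_gt0 -{1}(powRr1 a0) -{1}(mulfV (lt0r_neq0 q0)) powRrM.
  by apply: gt0_ltr_powR; rewrite ?invr_gt0 ?nnegrE ?powR_ge0// ltrDl.
move=> b b0; rewrite addrC subrK => h.
have e : ((a `^ q + 1) `^ q^-1) `^ q = a `^ q + 1.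
  by rewrite -powRrM mulVf ?gt_eqF// powRr1.
by rewrite -e ge0_ler_powR ?nnegrE ?powR_ge0// ltW.
Qed.

Section ell_trunc_small.
Context (R : realType) (s : scalars) (p : R) (p1 : 1 <= p).
Local Notation K := (scalar_field R s).
Local Notation E := (ell s p1).

Let p0 : 0 < p. Proof. exact: lt_le_trans p1. Qed.

Lemma rnorm_ell_trunc_sum (W : normedModType K) (T : bounded_op E W) n (x : E) c :
  0 <= c -> rnorm x <= 1 -> (forall i : 'I_n, rnorm (T (ell_unit s p1 i)) <= c / n.+1%:R) ->
  rnorm (T (ell_trunc n x)) <= c.
Proof.
move=> c0 x1 Tc; rewrite bounded_op_sum (le_trans (ler_rnorm_sum _ _))// big_mkord.
apply: (@le_trans _ _ (\sum_(i < n) c / n.+1%:R)).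
  apply: ler_sum => i _; rewrite bounded_opZ rnormZ (le_trans _ (Tc i))//.
  by rewrite ler_piMl ?rnorm_ge0// (le_trans (ell_coord_le _ _)).
rewrite sumr_const card_ord -[leLHS]mulr_natr -mulrA ler_piMr// mulrC ler_pdivrMr ?ltr0n//.
by rewrite mul1r ler_nat.
Qed.

Lemma weakly_null_ell_trunc (F : set_system E) (FF : ProperFilter F) n e :
  weakly_null F -> 0 < e -> \forall z \near F, rnorm (ell_trunc n z) < e.
Proof.
move=> Fn e0; have d0 : 0 < e / n.+1%:R by rewrite divr_gt0// ltr0n.
have near_coord : \forall z \near F, forall i : 'I_n, rnorm ((z : E) i) < e / n.+1%:R.
  by apply: filter_forall => i; exact: (Fn (ell_coord s p1 i)).
apply: filterS near_coord => z zi.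
rewrite /ell_trunc (le_lt_trans (ler_rnorm_sum _ _))// big_mkord.
apply: (@le_lt_trans _ _ (\sum_(i < n) e / n.+1%:R)).
  apply: ler_sum => i _; rewrite rnormZ rnorm_ell_unit mulr1; exact: ltW.
rewrite sumr_const card_ord -[ltLHS]mulr_natr -mulrA gtr_pMr// mulrC ltr_pdivrMr ?ltr0n//.
by rewrite mul1r ltr_nat.
Qed.

(** A head of [x] and a tail of [z] are disjoint and contribute at most [|x| ^ p + 1]; the tail of
    [x] and the head of [z] have total norm at most [d], which costs the other 1. *)
Lemma ell_smooth : asymptotically_smooth E p.
Proof.
move=> x F FF Fn F1; pose a := (rnorm x `^ p + 1) `^ p^-1.
have ap : a `^ p = rnorm x `^ p + 1.
  by rewrite /a -powRrM mulVf ?gt_eqF// powRr1// addr_ge0 ?powR_ge0.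
have [d d0 ad] := @powR_right_continuous R a p (powR_ge0 _ _) p0.
have d20 : 0 < d / 2 by rewrite divr_gt0.
have [n xn] := ell_tail_small x d20.
have zn := weakly_null_ell_trunc FF n Fn d20.
apply: filterS2 F1 zn => z z1 zn.
have -> : rnorm x `^ p + 2 = a `^ p + 1 by rewrite ap -addrA.
apply: ad; first exact: rnorm_ge0.
have -> : x + z = (ell_trunc n x + (z - ell_trunc n z)) + ((x - ell_trunc n x) + ell_trunc n z).
  by rewrite addrACA [ell_trunc n x + _]addrC subrK subrK.
apply: (le_trans (ler_rnormD _ _)); apply: lerD; last first.
  by rewrite [leRHS]splitr (le_trans (ler_rnormD _ _))// lerD// ltW.
apply: (le_of_powR_le p1); rewrite ?rnorm_ge0 ?powR_ge0// ap ell_disjoint; last first.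
  exact: ell_trunc_disjoint.
rewrite lerD//; first by rewrite ge0_ler_powR ?nnegrE ?rnorm_ge0 ?(ltW p0) ?rnorm_ell_trunc_le.
have <- : 1 `^ p = 1 :> R by rewrite powR1.
by rewrite ge0_ler_powR ?nnegrE ?rnorm_ge0 ?(ltW p0)// (le_trans (rnorm_ell_tail_le _ _)).
Qed.

End ell_trunc_small.

(** * Duality and the power types of the sequence spaces *)

Section ell_dual.
Context (R : realType) (s : scalars) (p : R) (p1 : 1 <= p).
Hypothesis p1' : 1 < p.
Local Notation K := (scalar_field R s).
Local Notation E := (ell s p1).
Local Notation re := (@to_real R s).

Let p0 : 0 < p. Proof. exact: lt_trans p1'. Qed.

(** A tail on which [f] is large is rotated to make the value real, then cut off so far out that the
    value lost is less than its excess over [eta]. *)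
Lemma ell_block (f : dual E) eta : 0 < eta ->
  (forall n, exists2 v : E, rnorm v <= 1 & eta < rnorm (f (v - ell_trunc n v))) ->
  forall n, exists u M, [/\ forall k, (M <= k)%N -> (u : E) k = 0, forall k, (k < n)%N -> u k = 0,
    rnorm u <= 1 & eta <= re (f u)].
Proof.
move=> eta0 hv n; have [v v1 fv] := hv n.
set w := v - ell_trunc n v in fv.
have [c c1 cw] := phase (f w).
pose w' : E := c *: w.
have fw' : re (f w') = rnorm (f w).
  by rewrite bounded_opZ -[_ *: _]/(c * f w) cw of_realK.
have w'1 : rnorm w' <= 1.
  by rewrite rnormZ mulr_ile1 ?rnorm_ge0// (le_trans (rnorm_ell_tail_le _ _)).
have f1 : 0 < rnorm f + 1 by rewrite ltr_wpDl ?rnorm_ge0.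
have d0 : 0 < (rnorm (f w) - eta) / (rnorm f + 1) by rewrite divr_gt0 ?subr_gt0.
have [M wM] := ell_tail_small w' d0.
exists (ell_trunc M w'), M; split.
- by move=> k Mk; rewrite ell_truncE ltnNge Mk.
- move=> k kn; rewrite ell_truncE; case: ifP => // _.
  by rewrite -[w' k]/(c * (v k - ell_trunc n v k)) ell_truncE kn subrr mulr0.
- exact: le_trans (rnorm_ell_trunc_le _ _) w'1.
- have -> : ell_trunc M w' = w' - (w' - ell_trunc M w') by rewrite opprB addrC subrK.
  rewrite bounded_opB to_realB fw'.
  have : re (f (w' - ell_trunc M w')) <= rnorm (f w) - eta; last by lra.
  rewrite (le_trans (ler_to_real _))// (le_trans (ler_rnorm_op _ _))//.
  apply: (@le_trans _ _ ((rnorm f + 1) * rnorm (w' - ell_trunc M w'))).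
    by rewrite ler_wpM2r ?rnorm_ge0// lerDl.
  by rewrite mulrC -ler_pdivlMr// ltW.
Qed.

(* Otherwise disjoint blocks u_1, ..., u_m of norm at most 1 with Re f(u_i) >= e
   would give m e <= |f| m^(1/p). *)
Lemma ell_dual_tail (f : dual E) eta : 0 < eta ->
  exists n, forall v : E, rnorm v <= 1 -> rnorm (f (v - ell_trunc n v)) <= eta.
Proof.
move=> eta0; apply: contrapT => hn.
have hv n : exists2 v : E, rnorm v <= 1 & eta < rnorm (f (v - ell_trunc n v)).
  apply: contrapT => nv; apply: hn; exists n => v v1; rewrite leNgt; apply/negP => h.
  by apply: nv; exists v.
have blocks m : exists (u : E) M, [/\ forall k, (M <= k)%N -> u k = 0,
    rnorm u `^ p <= m%:R & m%:R * eta <= re (f u)].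
  elim: m => [|m [u [M [uM um fu]]]].
    exists 0, 0%N; split => //; first by rewrite rnorm0 powR0// gt_eqF.
    by rewrite mul0r bounded_op0 to_real0.
  have [u' [M' [uM' u'0 u'1 fu']]] := ell_block eta0 hv M.
  exists (u + u'), (maxn M M'); split.
  - move=> k; rewrite geq_max => /andP[Mk M'k].
    by rewrite -[(u + u') k]/(u k + u' k) uM// uM'// addr0.
  - rewrite ell_disjoint; last by move=> k; have [kM|Mk] := ltnP k M; [right; exact: u'0|left; exact: uM].
    rewrite -[m.+1%:R]natr1 lerD//; have <- : 1 `^ p = 1 :> R by rewrite powR1.
    by rewrite ge0_ler_powR ?nnegrE ?rnorm_ge0 ?(ltW p0).
  - by rewrite bounded_opD to_realD -[m.+1%:R]natr1 mulrDl mul1r lerD.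
(* The blocks give [m ^ (1 - 1 / p) <= |f| / eta], that is [m <= c], which fails for the integer
   just above [c]. *)
pose q := 1 - p^-1; have q0 : 0 < q by rewrite subr_gt0 invf_lt1.
pose c := (rnorm f / eta) `^ q^-1.
have c0 : 0 <= c by rewrite powR_ge0.
pose m := (Num.trunc c).+1.
have /andP[_ cm] : _ := truncn_itv c0; rewrite -/m in cm.
have m0 : 0 < m%:R :> R by rewrite ltr0n.
have [u [M [_ um fu]]] := blocks m.
have h1 : m%:R * eta <= rnorm f * m%:R `^ p^-1.
  rewrite (le_trans fu)// (le_trans (ler_to_real _))// (le_trans (ler_rnorm_op _ _))//.
  rewrite ler_wpM2l ?rnorm_ge0//; apply: (le_of_powR_le p1); rewrite ?rnorm_ge0 ?powR_ge0//.
  by rewrite -powRrM mulVf ?gt_eqF// powRr1// ltW.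
have h2 : m%:R `^ q <= rnorm f / eta.
  rewrite ler_pdivlMr// -(ler_pM2r (powR_gt0 p^-1 m0)) mulrAC -powRD.
    by rewrite /q subrK powRr1// ltW.
  by rewrite (gt_eqF m0) implybT.
have : m%:R <= c.
  have <- : (m%:R `^ q) `^ q^-1 = m%:R by rewrite -powRrM mulfV ?gt_eqF// powRr1// ltW.
  apply: ge0_ler_powR => //; rewrite ?nnegrE ?powR_ge0 ?invr_ge0 ?(ltW q0)//.
  by rewrite divr_ge0 ?rnorm_ge0// ltW.
by rewrite leNgt cm.
Qed.

Lemma weakly_null_dual_trunc (F : set_system (dual E)) (FF : ProperFilter F) n e :
  weakly_null F -> 0 < e ->
  \forall z \near F, forall v : E, rnorm v <= 1 -> rnorm ((z : dual E) (ell_trunc n v)) <= e.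
Proof.
move=> Fn e0; have d0 : 0 < e / n.+1%:R by rewrite divr_gt0// ltr0n.
have near_coord : \forall z \near F, forall i : 'I_n, rnorm ((z : dual E) (ell_unit s p1 i)) < e / n.+1%:R.
  by apply: filter_forall => i; exact: (Fn (eval_dual (ell_unit s p1 i))).
apply: filterS near_coord => z zi v v1.
by apply: rnorm_ell_trunc_sum => //; [exact: ltW|move=> i; exact: ltW].
Qed.

Lemma conjugate_sum : (p / (p - 1))^-1 + p^-1 = 1.
Proof.
have pm : p - 1 != 0 by rewrite subr_eq0 gt_eqF.
by field; rewrite pm gt_eqF.
Qed.

Lemma conjugate_gt1 : 1 < p / (p - 1).
Proof. by rewrite ltr_pdivlMr ?subr_gt0// mul1r gtrBl. Qed.

(** On a vector [v], the functional [f] acts mainly on the head and [z] on the tail. Two-term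
    Hoelder combines them, since the p-th powers of the norms of head and tail add up to that of
    [v]. *)
Lemma dual_ell_smooth : asymptotically_smooth (dual E) (p / (p - 1)).
Proof.
set q := p / (p - 1).
have q0 : 0 < q by rewrite (lt_trans ltr01)// conjugate_gt1.
move=> f F FF Fn F1; pose a := (rnorm f `^ q + 1) `^ q^-1.
have aq : a `^ q = rnorm f `^ q + 1.
  by rewrite /a -powRrM mulVf ?gt_eqF// powRr1// addr_ge0 ?powR_ge0.
have [d d0 ad] := @powR_right_continuous R a q (powR_ge0 _ _) q0.
have d20 : 0 < d / 2 by rewrite divr_gt0.
have [n fn] := ell_dual_tail f d20.
have zn := weakly_null_dual_trunc FF n Fn d20.
apply: filterS2 F1 zn => z z1 zn.
have -> : rnorm f `^ q + 2 = a `^ q + 1 by rewrite aq -addrA.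
apply: ad; first exact: rnorm_ge0.
apply: rnorm_op_le => v v1.
have -> : (f + z) v = (f (ell_trunc n v) + z (v - ell_trunc n v)) +
    (f (v - ell_trunc n v) + z (ell_trunc n v)).
  rewrite addrACA -bounded_opD [ell_trunc n v + _]addrC subrK.
  by rewrite -bounded_opD subrK.
apply: (le_trans (ler_rnormD _ _)); apply: lerD; last first.
  by rewrite [leRHS]splitr (le_trans (ler_rnormD _ _))// lerD// ?fn ?zn.
apply: (@le_trans _ _ (rnorm f * rnorm (ell_trunc n v) + 1 * rnorm (v - ell_trunc n v))).
  rewrite (le_trans (ler_rnormD _ _))// lerD ?ler_rnorm_op//.
  by rewrite (le_trans (ler_rnorm_op _ _))// ler_wpM2r ?rnorm_ge0.
apply: (le_trans (hoelder2 (rnorm_ge0 _) ler01 (rnorm_ge0 _) (rnorm_ge0 _) q0 p0 conjugate_sum)).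
rewrite powR1 -/a ler_piMr ?powR_ge0// rnorm_ell_trunc.
by rewrite -powRrM mulfV ?gt_eqF// powRr1 ?rnorm_ge0.
Qed.

Lemma dual_ell_finite_szlenk : finite_szlenk (dual E).
Proof. exact: smooth_finite_szlenk conjugate_gt1 dual_ell_smooth. Qed.

Lemma ell_unit_tail n m : (n <= m)%N ->
  ell_unit s p1 m - ell_trunc n (ell_unit s p1 m) = ell_unit s p1 m.
Proof.
move=> nm; apply/val_inj/funext => k.
rewrite -[LHS]/(ell_unit s p1 m k - ell_trunc n (ell_unit s p1 m) k) ell_truncE.
case: ifPn => kn; last by rewrite subr0.
by rewrite subrr -[RHS]/(ell_unit s p1 m k) ell_unitE (ltn_eqF (leq_trans kn nm)).
Qed.

(** The exponent [p / (p - 1)] of smoothness has conjugate [p]. The matching lower bound uses the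
    unit vectors in the bidual; they are weak*-null because every functional is small on tails. *)
Lemma dual_ell_szlenk_power_type : szlenk_power_type (dual E) = p.
Proof.
apply: le_anti; apply/andP; split.
  have pq : (p / (p - 1)) / (p / (p - 1) - 1) = p.
    have pm : p - 1 != 0 by rewrite subr_eq0 gt_eqF.
    have -> : p / (p - 1) - 1 = (p - 1)^-1 by field.
    by rewrite invrK divfK.
  rewrite -[leRHS]pq; exact: smooth_szlenk_power_type conjugate_gt1 dual_ell_smooth.
apply: (@basis_szlenk_power_type R s (dual E) p (fun m => eval_dual (ell_unit s p1 m)) p0 dual_ell_finite_szlenk).
- move=> f; apply/cvg_rnormP => e e0.
  have e20 : 0 < e / 2 by rewrite divr_gt0.
  have [n fn] := ell_dual_tail f e20; near=> m.
  have nm : (n <= m)%N by near: m; exact: nbhs_infty_ge.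
  rewrite subr0 -[eval_dual _ _]/(f (ell_unit s p1 m)) -(ell_unit_tail nm).
  rewrite (le_lt_trans (fn _ _)) ?rnorm_ell_unit//.
  by rewrite ltr_pdivrMr// ltr_pMr// ltr1n.
- move=> m; have : rnorm (eval_dual (ell_unit s p1 m) (ell_coord s p1 m)) <=
      rnorm (eval_dual (ell_unit s p1 m)) * 1.
    rewrite (le_trans (ler_rnorm_op _ _))// ler_wpM2l ?rnorm_ge0//.
    exact: rnorm_bounded_op_of.
  rewrite mulr1; apply: le_trans.
  by rewrite -[eval_dual _ _]/(ell_unit s p1 m m) ell_unitE eqxx rnorm1.
- move=> F uF.
  have -> : \sum_(i <- F) eval_dual (ell_unit s p1 i) = eval_dual (\sum_(i <- F) ell_unit s p1 i).
    by apply/val_inj/funext => f; rewrite /= sum_bounded_opE bounded_op_sum.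
  by rewrite (le_trans (rnorm_eval_dual _))// rnorm_ell_sum_unit.
Unshelve. all: by end_near.
Qed.

(** Hoelder against the constant 1, built up from its two-term case. *)
Lemma sum_le_powR_size (r : seq nat) (a : nat -> R) : (forall k, 0 <= a k) ->
  \sum_(k <- r) a k <= (size r)%:R `^ (p / (p - 1))^-1 * (\sum_(k <- r) a k `^ p) `^ p^-1.
Proof.
set q := p / (p - 1); have q0 : 0 < q by rewrite (lt_trans ltr01)// conjugate_gt1.
move=> a0; elim: r => [|k r IH].
  by rewrite !big_nil powR0 ?invr_neq0 ?gt_eqF// mul0r.
rewrite !big_cons; apply: (@le_trans _ _ (1 * a k +
    (size r)%:R `^ q^-1 * (\sum_(k <- r) a k `^ p) `^ p^-1)).
  by rewrite mul1r lerD2l.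
apply: (le_trans (hoelder2 ler01 (powR_ge0 _ _) (a0 k) (powR_ge0 _ _) q0 p0 conjugate_sum)).
rewrite powR1 -!powRrM !mulVf ?gt_eqF// !powRr1 ?sumr_ge0//; last by move=> i _; exact: powR_ge0.
by rewrite nat1r.
Qed.

Lemma sum_uniq_le_ell (r : seq nat) (x : E) : uniq r ->
  \sum_(k <- r) rnorm (x k) `^ p <= rnorm x `^ p.
Proof.
move=> ur; pose n := (\max_(k <- r) k).+1.
apply: le_trans (ell_partial_le x n).
have perm : perm_eq r [seq k <- iota 0 n | k \in r].
  apply: uniq_perm => //; first by rewrite filter_uniq ?iota_uniq.
  move=> k; rewrite mem_filter mem_iota /= add0n; case: (boolP (k \in r)) => //= kr.
  by rewrite ltnS leq_bigmax_seq.
rewrite (perm_big _ perm) big_filter /index_iota subn0.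
by rewrite [leRHS](bigID (fun k => k \in r))/= lerDl sumr_ge0// => i _; exact: powR_ge0.
Qed.

Lemma ell_finite_szlenk : finite_szlenk E.
Proof. exact: smooth_finite_szlenk p1' (ell_smooth (p1 := p1)). Qed.

(** The lower bound uses the coordinate functionals: by Hoelder, a sum of [n] of them has norm at
    most [n ^ (1 / p')], with [p'] conjugate to [p]. *)
Lemma ell_szlenk_power_type : szlenk_power_type E = p / (p - 1).
Proof.
apply: le_anti; apply/andP; split.
  exact: smooth_szlenk_power_type p1' (ell_smooth (p1 := p1)).
have q0 : 0 < p / (p - 1) by rewrite (lt_trans ltr01)// conjugate_gt1.
apply: (@basis_szlenk_power_type R s E _ (ell_coord s p1) q0 ell_finite_szlenk).
- move=> x; apply/cvg_rnormP => e e0.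
  have [n xn] := ell_tail_small x e0; near=> m.
  have nm : (n <= m)%N by near: m; exact: nbhs_infty_ge.
  rewrite subr0 (le_lt_trans _ xn)//.
  have -> : ell_coord s p1 m x = (x - ell_trunc n x) m.
    by rewrite -[RHS]/(x m - ell_trunc n x m) ell_truncE ltnNge nm subr0.
  exact: ell_coord_le.
- move=> m; have := ler_rnorm_op (ell_coord s p1 m) (ell_unit s p1 m).
  by rewrite rnorm_ell_unit mulr1 ell_coordE ell_unitE eqxx rnorm1.
- move=> F uF; apply: rnorm_op_le => x x1.
  rewrite sum_bounded_opE (le_trans (ler_rnorm_sum _ _))//.
  apply: (le_trans (sum_le_powR_size F (fun k => rnorm_ge0 (x k : K^o)))).
  rewrite ler_piMr ?powR_ge0//.
  have <- : 1 `^ p^-1 = 1 :> R by rewrite powR1.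
  apply: ge0_ler_powR; rewrite ?nnegrE ?invr_ge0 ?(ltW p0) ?ler01//.
    by rewrite sumr_ge0// => i _; exact: powR_ge0.
  rewrite (le_trans (sum_uniq_le_ell x uF))//.
  have <- : 1 `^ p = 1 :> R by rewrite powR1.
  by rewrite ge0_ler_powR ?nnegrE ?rnorm_ge0 ?(ltW p0).
Unshelve. all: by end_near.
Qed.

Lemma ell_neq0 : exists x : E, x != 0.
Proof.
exists (ell_unit s p1 0); apply/eqP => e0.
have := rnorm_ell_unit s p1 0; rewrite e0 rnorm0 => /eqP.
by rewrite eq_sym oner_eq0.
Qed.

End ell_dual.

Theorem mainTheorem2 (R : realType) (s : scalars) :
  (forall X Y : completeNormedModType (scalar_field R s),
     (exists x : X, x != 0) -> (exists y : Y, y != 0) ->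
     approximation_property (dual X) \/ approximation_property Y ->
     szlenk_le_omega (dual X) -> szlenk_le_omega Y ->
     szlenk_le_omega (compact_op X Y) /\
     szlenk_power_type (compact_op X Y) =
       Num.max (szlenk_power_type (dual X)) (szlenk_power_type Y)) /\
  (forall (p q : R) (p1 : 1 < p) (q1 : 1 < q),
     szlenk_le_omega (compact_op (ell s (ltW p1)) (ell s (ltW q1))) /\
     szlenk_power_type (compact_op (ell s (ltW p1)) (ell s (ltW q1))) =
       Num.max p (q / (q - 1))).
Proof.
split=> [X Y X0 Y0 _|p q p1 q1]; first exact: szlenk_power_type_compact_op.
have [] := @szlenk_power_type_compact_op R s (ell s (ltW p1)) (ell s (ltW q1)).
- exact: ell_neq0.
- exact: ell_neq0.
- exact/szlenk_le_omegaP/dual_ell_finite_szlenk.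
- exact/szlenk_le_omegaP/ell_finite_szlenk.
by rewrite dual_ell_szlenk_power_type// ell_szlenk_power_type.
Qed.
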